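(* Let $N\ge3$ and suppose the Convexity Assumption and the Lipschitz Assumption (see context) hold. Let $c_0>0$ be fixed, let $T\ge1$ and set $\delta=c_0/\sqrt T$. Let $(\bar{\mathbf x},\bar{\mathbf y})$ be generated by applying the SEG-ADMM algorithm for $T$ iterations to the perturbed problem $$\min_{\mathbf x\in\mathcal X}\max_{\mathbf y\in\mathcal Y}\ \Phi_\delta(\mathbf x,\mathbf y):=\Phi(\mathbf x,\mathbf y)+\frac\delta2\sum_{i=2}^N\|x_i-x_i^0\|^2\quad\text{s.t.}\quad A\mathbf x=a,$$ with $\gamma=\frac{\delta}{N(N-1)\max_{2\le i\le N}\{\|A_i\|^2\}}$, $H_i\succeq(L_{\mathbf x}+L_{\mathbf y})I$ for $i=1,\dots,N$, and $G\succeq L_{\mathbf y}I$ (all positive definite, independent of $T$). Then for every $\rho>0$, $$\max_{\mathbf y\in\mathcal Y}\Phi(\bar{\mathbf x},\mathbf y)-\min_{\mathbf x\in\mathcal X,\,A\mathbf x=a}\Phi(\mathbf x,\bar{\mathbf y})+\rho\|A\bar{\mathbf x}-a\|\le\mathcal O\Big(\frac1{\sqrt T}\Big),$$ where the hidden constant does not depend on $T$ (it may depend on $\rho$, $c_0$, $H$, $G$ and the problem data). Therefore it takes $T=\mathcal O(\epsilon^{-2})$ iterations to reach an $\epsilon$-saddle point of the original problem; that is, there is a constant $C$ independent of $\epsilon$ such that for every $\epsilon\in(0,1]$ some $T\le C\epsilon^{-2}$ makes the output an $\epsilon$-saddle point.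
   Context: **Problem.** $\min_{\mathbf x\in\mathcal X}\max_{\mathbf y\in\mathcal Y}\Phi(\mathbf x,\mathbf y):=\sum_{i=1}^N h_i(x_i,\mathbf y)+\Psi(\mathbf x,\mathbf y)$ subject to $A\mathbf x=a$, where $\mathbf x=(x_1,\dots,x_N)$, $\mathcal X=\mathcal X_1\times\cdots\times\mathcal X_N$, the sets $\mathcal X_i\subset\mathbb R^{d_i}$ and $\mathcal Y\subset\mathbb R^{d}$ are compact and convex, $A=[A_1,\dots,A_N]$ with $A_i\in\mathbb R^{n\times d_i}$ (not all of $A_2,\dots,A_N$ zero), $a\in\mathbb R^n$, so $A\mathbf x=\sum_iA_ix_i$. In the perturbed problem the term $\frac\delta2\|x_i-x_i^0\|^2$ is absorbed into $h_i$ for $i\ge2$ (so $h_i$ is replaced by $h_i(x_i,\mathbf y)+\frac\delta2\|x_i-x_i^0\|^2$ and $\Psi$ is unchanged), and $x_i^0$ is the $i$-th block of the initial iterate $\mathbf x^0$. **Slater's condition** (standing): there is $(\hat{\mathbf x},\hat{\mathbf y})\in\mathrm{int}(\mathcal X)\times\mathrm{int}(\mathcal Y)$ with $A\hat{\mathbf x}=a$. **Notation.** $\|\cdot\|$ is the Euclidean norm of vectors and the spectral norm of matrices; $\|v\|_M^2=v^\top Mv$ for symmetric $M$; $\succ,\succeq$ denote the Loewner order on symmetric matrices; $H=\mathrm{Diag}(H_1,\dots,H_N)$. **Convexity Assumption.** For every $\mathbf x\in\mathcal X$, $\Phi(\mathbf x,\cdot)$ is concave and upper semicontinuous on $\mathcal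 Y$. For every $\mathbf y\in\mathcal Y$ and every $i$, $h_i(\cdot,\mathbf y)$ is convex and lower semicontinuous on $\mathcal X_i$. $\Phi$ is bounded on $\mathcal X\times\mathcal Y$. For every $\mathbf y\in\mathcal Y$, $\Psi(\cdot,\mathbf y)$ is smooth and convex on $\mathcal X$, and $\|\nabla_{\mathbf x}\Psi(\mathbf x,\mathbf y)-\nabla_{\mathbf x}\Psi(\mathbf x',\mathbf y)\|\le L_{\mathbf x}\|\mathbf x-\mathbf x'\|$ for all $\mathbf x,\mathbf x'\in\mathcal X$, $\mathbf y\in\mathcal Y$. **Lipschitz Assumption.** $\Phi(\mathbf x,\cdot)$ is differentiable and $\|\nabla_{\mathbf y}\Phi(\mathbf x,\mathbf y)-\nabla_{\mathbf y}\Phi(\mathbf x',\mathbf y')\|\le L_{\mathbf y}\sqrt{\|\mathbf x-\mathbf x'\|^2+\|\mathbf y-\mathbf y'\|^2}$ for all $\mathbf x,\mathbf x'\in\mathcal X$, $\mathbf y,\mathbf y'\in\mathcal Y$. **Linearized augmented Lagrangian** (of a problem with data $h_i,\Psi$). $\mathcal L_\gamma(\mathbf x,\lambda;\tilde{\mathbf x},\tilde{\mathbf y})=\sum_{i=1}^Nh_i(x_i,\tilde{\mathbf y})+\langle\nabla_{\mathbf x}\Psi(\tilde{\mathbf x},\tilde{\mathbf y}),\mathbf x-\tilde{\mathbf x}\rangle-\langle\lambda,A\mathbf x-a\rangle+\frac\gamma2\|A\mathbf x-a\|^2$. **Prox-ADMM step.** Given $\mathbf x\in\mathcal X$, $\lambda\in\mathbb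 R^n$, $\mathbf y\in\mathcal Y$, $\gamma>0$, $H_i\succ0$, the output $(\mathbf x^+,\lambda^+)=\texttt{Prox-ADMM}(\mathbf x,\lambda;\mathbf y;\gamma,\{H_i\})$ is defined by: for $i=1,\dots,N$ successively, $$x_i^+=\arg\min_{w_i\in\mathcal X_i}\mathcal L_\gamma\big((x_1^+,\dots,x_{i-1}^+,w_i,x_{i+1},\dots,x_N),\lambda;\mathbf x,\mathbf y\big)+\tfrac12\|w_i-x_i\|_{H_i}^2,$$ and then $\lambda^+=\lambda-\gamma(A\mathbf x^+-a)$. **SEG-ADMM algorithm** (for a problem with objective $\Phi$; here applied with $\Phi_\delta$). Start from $\mathbf x^0\in\mathcal X$, $\mathbf y^0\in\mathcal Y$, $\lambda^0=0$, with $\gamma>0$, $G\succ0$, $H_i\succ0$. For $k=0,1,\dots$: (1) $\hat{\mathbf y}^{k+1}=\arg\min_{\mathbf y\in\mathcal Y}\frac12\|\mathbf y-[\mathbf y^k+G^{-1}\nabla_{\mathbf y}\Phi(\mathbf x^k,\mathbf y^k)]\|_G^2$; (2) $(\mathbf x^{k+1},\lambda^{k+1})=\texttt{Prox-ADMM}(\mathbf x^k,\lambda^k;\hat{\mathbf y}^{k+1};\gamma,\{H_i\})$; (3) $\mathbf y^{k+1}=\arg\min_{\mathbf y\in\mathcal Y}\frac12\|\mathbf y-[\mathbf y^k+G^{-1}\nabla_{\mathbf y}\Phi(\mathbf x^{k+1},\hat{\mathbf y}^{k+1})]\|_G^2$. The output after $T$ iterations is $\bar{\mathbf x}=\frac1T\sum_{k=1}^T\mathbf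 x^k$, $\bar{\mathbf y}=\frac1T\sum_{k=1}^{T}\hat{\mathbf y}^k$. **$\epsilon$-saddle point.** $(\bar{\mathbf x},\bar{\mathbf y})\in\mathcal X\times\mathcal Y$ is an $\epsilon$-saddle point if $\max_{\mathbf y\in\mathcal Y}\Phi(\bar{\mathbf x},\mathbf y)-\min_{\mathbf x\in\mathcal X,A\mathbf x=a}\Phi(\mathbf x,\bar{\mathbf y})\in[-\epsilon,\epsilon]$ and $\|A\bar{\mathbf x}-a\|\le\epsilon$. *)

(* Defs.v *)
From HB Require Import structures.
From mathcomp Require Import all_boot all_order all_algebra.
From mathcomp Require Import all_classical all_reals all_analysis.

Set Implicit Arguments.
Unset Strict Implicit.
Unset Printing Implicit Defensive.

Import Order.TTheory GRing.Theory Num.Theory.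
Import numFieldNormedType.Exports.

Local Open Scope classical_set_scope.
Local Open Scope ring_scope.

(* The norm carried by 'M[R]_(m, n) in the library is the sup norm: it is used
   below only through the topology it induces.  Every norm occurring in a
   formula is one of the following. *)
Definition dot (R : realType) k (u v : 'cV[R]_k) : R := (u^T *m v) 0 0.

Definition enorm (R : realType) k (u : 'cV[R]_k) : R := Num.sqrt (dot u u).

Definition sqnorm_mx (R : realType) k (M : 'M[R]_k) (v : 'cV[R]_k) : R :=
  dot v (M *m v).

Definition spectral_norm (R : realType) p q (M : 'M[R]_(p, q)) : R :=
  sup [set enorm (M *m v) | v in [set v : 'cV[R]_q | enorm v <= 1]].

(* The Loewner order [M1 >= M2] on symmetric matrices is [psd (M1 - M2)] *)
Definition psd (R : realType) k (M : 'M[R]_k) : Prop :=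
  M^T = M /\ forall v, 0 <= sqnorm_mx M v.

Definition pd (R : realType) k (M : 'M[R]_k) : Prop :=
  M^T = M /\ forall v, v != 0 -> 0 < sqnorm_mx M v.

(* Semicontinuity relative to [D], i.e. for the subspace topology. *)
Definition lsc_on (R : realType) k (D : set 'cV[R]_k) (f : 'cV[R]_k -> R) :=
  lower_semicontinuous (fun x : subspace D => (f x)%:E).

Definition usc_on (R : realType) k (D : set 'cV[R]_k) (f : 'cV[R]_k -> R) :=
  lsc_on D (fun x => - f x).

Definition concave_function (R : realType) k (D : set 'cV[R]_k)
    (f : 'cV[R]_k -> R) :=
  convex_function D (fun x => - f x).

(* Frechet derivative relative to [D]: only the values of [f] on [D] matter, so
   that it makes sense at the boundary points of [D] for a function given on [D]
   only.  At interior points this is the usual gradient; the gradient is unique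
   at every point of a convex set [D] with nonempty interior. *)
Definition is_grad_on (R : realType) k (D : set 'cV[R]_k) (f : 'cV[R]_k -> R)
    (x g : 'cV[R]_k) : Prop :=
  (f z - f x - dot g (z - x)) / enorm (z - x) @[z --> within D x^'] --> (0 : R).

Definition differentiable_on (R : realType) k (D : set 'cV[R]_k)
    (f : 'cV[R]_k -> R) : Prop :=
  forall x, D x -> exists g, is_grad_on D f x g.

Definition grad_on (R : realType) k (D : set 'cV[R]_k) (f : 'cV[R]_k -> R)
    (x : 'cV[R]_k) : 'cV[R]_k :=
  xget 0 [set g | is_grad_on D f x g].

Definition argmin (R : realType) k (D : set 'cV[R]_k) (f : 'cV[R]_k -> R) :
    'cV[R]_k :=
  xget 0 [set w | D w /\ forall w', D w' -> f w <= f w'].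

(* Data of  min_(x in X) max_(y in Y) sum_i h_i(x_i, y) + Psi(x, y)
   subject to A x = a.  The vector x = (x_1, ..., x_N) is the stacked column
   vector of its blocks; the blocks 1, ..., N are indexed by 0, ..., N - 1. *)
Record problem (R : realType) (N : nat) (d : 'I_N -> nat) (m n : nat) := Problem {
  Xblk : forall i : 'I_N, set 'cV[R]_(d i);
  Yset : set 'cV[R]_m;
  hfun : forall i : 'I_N, 'cV[R]_(d i) -> 'cV[R]_m -> R;
  Psi  : 'cV[R]_(\sum_i d i) -> 'cV[R]_m -> R;
  Ablk : forall i : 'I_N, 'M[R]_(n, d i);
  avec : 'cV[R]_n }.

Arguments Xblk {R N d m n} _ _.
Arguments hfun {R N d m n} _ _ _ _.

Definition blk (R : realType) (N : nat) (d : 'I_N -> nat)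
    (x : 'cV[R]_(\sum_i d i)) (i : 'I_N) : 'cV[R]_(d i) := submxcol x i.

Definition set_blk (R : realType) (N : nat) (d : 'I_N -> nat)
    (x : 'cV[R]_(\sum_i d i)) (i : 'I_N) (w : 'cV[R]_(d i)) :
    'cV[R]_(\sum_i d i) :=
  \mxcol_(j < N) dfwith (blk x) i w j.

Section Problem.
Variables (R : realType) (N : nat) (d : 'I_N -> nat) (m n : nat).
Variable P : problem R d m n.

Notation xT := 'cV[R]_(\sum_i d i).
Notation yT := 'cV[R]_m.

Definition Xset : set xT := [set x | forall i, Xblk P i (blk x i)].

Definition Amx : 'M[R]_(n, \sum_i d i) := \mxrow_(i < N) Ablk P i.

Definition residual (x : xT) : 'cV[R]_n := Amx *m x - avec P.

Definition Phi (x : xT) (y : yT) : R :=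
  \sum_(i < N) hfun P i (blk x i) y + Psi P x y.

Definition gradx_Psi (x : xT) (y : yT) : xT :=
  grad_on Xset (fun z => Psi P z y) x.

Definition grady_Phi (x : xT) (y : yT) : yT := grad_on (Yset P) (Phi x) y.

Definition compact_convex_sets : Prop :=
  [/\ forall i, compact (Xblk P i), forall i, convex_set (Xblk P i),
      compact (Yset P) & convex_set (Yset P)].

Definition slater : Prop :=
  exists x y, [/\ Xset° x, (Yset P)° y & Amx *m x = avec P].

Definition convexity_assumption (Lx : R) : Prop :=
  [/\ forall x, Xset x ->
        concave_function (Yset P) (Phi x) /\ usc_on (Yset P) (Phi x),
      forall y, Yset P y -> forall i,
        convex_function (Xblk P i) (fun w => hfun P i w y) /\
        lsc_on (Xblk P i) (fun w => hfun P i w y),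
      exists B : R, forall x y, Xset x -> Yset P y -> `|Phi x y| <= B,
      forall y, Yset P y ->
        differentiable_on Xset (fun x => Psi P x y) /\
        convex_function Xset (fun x => Psi P x y) &
      forall x x' y, Xset x -> Xset x' -> Yset P y ->
        enorm (gradx_Psi x y - gradx_Psi x' y) <= Lx * enorm (x - x')].

Definition lipschitz_assumption (Ly : R) : Prop :=
  (forall x, Xset x -> differentiable_on (Yset P) (Phi x)) /\
  (forall x x' y y', Xset x -> Xset x' -> Yset P y -> Yset P y' ->
     enorm (grady_Phi x y - grady_Phi x' y')
       <= Ly * Num.sqrt (enorm (x - x') ^+ 2 + enorm (y - y') ^+ 2)).

Definition lin_aug_lagrangian (gamma : R) (x : xT) (lambda : 'cV[R]_n)
    (xt : xT) (yt : yT) : R :=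
  \sum_(i < N) hfun P i (blk x i) yt + dot (gradx_Psi xt yt) (x - xt)
  - dot lambda (residual x) + gamma / 2 * enorm (residual x) ^+ 2.

Variables (gamma : R) (H : forall i, 'M[R]_(d i)) (G : 'M[R]_m).

(* One block update; [z] is the current point (x_1^+, ..., x_(i-1)^+, x_i, ...) *)
Definition prox_block (x : xT) (lambda : 'cV[R]_n) (y : yT) (z : xT) (i : 'I_N) :
    xT :=
  set_blk z (argmin (Xblk P i) (fun w =>
    lin_aug_lagrangian gamma (set_blk z w) lambda x y
    + 2^-1 * sqnorm_mx (H i) (w - blk x i))).

(* [enum 'I_N] lists the blocks in increasing order. *)
Definition prox_admm (x : xT) (lambda : 'cV[R]_n) (y : yT) : xT * 'cV[R]_n :=
  let xp := foldl (prox_block x lambda y) x (enum 'I_N) in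
  (xp, lambda - gamma *: residual xp).

Definition ystep (y g : yT) : yT :=
  argmin (Yset P) (fun w => 2^-1 * sqnorm_mx G (w - (y + invmx G *m g))).

Record state := State { st_x : xT; st_lambda : 'cV[R]_n; st_y : yT }.

(* yhat^(k+1) as a function of the k-th iterate *)
Definition seg_yhat (s : state) : yT :=
  ystep (st_y s) (grady_Phi (st_x s) (st_y s)).

Definition seg_step (s : state) : state :=
  let yh := seg_yhat s in
  let xl := prox_admm (st_x s) (st_lambda s) yh in
  State xl.1 xl.2 (ystep (st_y s) (grady_Phi xl.1 yh)).

Definition seg_iter (x0 : xT) (y0 : yT) (k : nat) : state :=
  iter k seg_step (State x0 0 y0).

Definition seg_xbar (x0 : xT) (y0 : yT) (T : nat) : xT :=
  T%:R^-1 *: \sum_(k < T) st_x (seg_iter x0 y0 k.+1).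

Definition seg_ybar (x0 : xT) (y0 : yT) (T : nat) : yT :=
  T%:R^-1 *: \sum_(k < T) seg_yhat (seg_iter x0 y0 k).

(* Both extrema are attained under the standing assumptions when [x] is in X and
   [y] in Y, so that [sup] and [inf] are the maximum and the minimum. *)
Definition gap (x : xT) (y : yT) : R :=
  sup [set Phi x y' | y' in Yset P]
  - inf [set Phi x' y | x' in [set x' | Xset x' /\ Amx *m x' = avec P]].

Definition eps_saddle_point (eps : R) (x : xT) (y : yT) : Prop :=
  [/\ Xset x, Yset P y, - eps <= gap x y <= eps & enorm (residual x) <= eps].

End Problem.

(* The proximal terms are absorbed into h_i for all blocks but the first. *)
Definition perturbed (R : realType) (N : nat) (d : 'I_N -> nat) (m n : nat)
    (P : problem R d m n) (delta : R) (x0 : 'cV[R]_(\sum_i d i)) :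
    problem R d m n :=
  Problem (Xblk P) (Yset P)
    (fun (i : 'I_N) w y => hfun P i w y +
       (if (0 < i)%N then delta / 2 * enorm (w - blk x0 i) ^+ 2 else 0))
    (Psi P) (Ablk P) (avec P).

Definition delta_of (R : realType) (c0 : R) (T : nat) : R :=
  c0 / Num.sqrt T%:R.

Definition gamma_of (R : realType) (N : nat) (d : 'I_N -> nat) (m n : nat)
    (P : problem R d m n) (delta : R) : R :=
  delta / (N%:R * (N%:R - 1) *
    \big[Num.max/0]_(i < N | (0 < i)%N) spectral_norm (Ablk P i) ^+ 2).

Definition xbar (R : realType) (N : nat) (d : 'I_N -> nat) (m n : nat)
    (P : problem R d m n) (H : forall i, 'M[R]_(d i)) (G : 'M[R]_m) (c0 : R)
    (x0 : 'cV[R]_(\sum_i d i)) (y0 : 'cV[R]_m) (T : nat) :=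
  seg_xbar (perturbed P (delta_of c0 T) x0) (gamma_of P (delta_of c0 T))
    H G x0 y0 T.

Definition ybar (R : realType) (N : nat) (d : 'I_N -> nat) (m n : nat)
    (P : problem R d m n) (H : forall i, 'M[R]_(d i)) (G : 'M[R]_m) (c0 : R)
    (x0 : 'cV[R]_(\sum_i d i)) (y0 : 'cV[R]_m) (T : nat) :=
  seg_ybar (perturbed P (delta_of c0 T) x0) (gamma_of P (delta_of c0 T))
    H G x0 y0 T.

(* Main.v *)
Require Import Defs.
From mathcomp Require Import all_boot all_order all_algebra.
From mathcomp Require Import all_classical all_reals all_analysis.
From mathcomp Require Import ring lra.
Import Order.TTheory GRing.Theory Num.Theory.
Import numFieldNormedType.Exports.
Local Open Scope classical_set_scope.
Local Open Scope ring_scope.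

(** The argument is a Lyapunov analysis of the algorithm on the perturbed problem,
    followed by a choice of the comparison points.

    Fix a feasible point [xs] of X, a point [ys] of Y and an arbitrary multiplier
    [lams].  Along one iteration (x, lambda, y) -> (x+, lambda+, y+), with
    extrapolated dual point [yh], [seg_step_descent] shows that
      Phi(x+, ys) - Phi(xs, yh) - <lams, A x+ - a>
        <= (delta / 2) sum_(i >= 2) |xs_i - x0_i|^2 + V - V+,
    where the Lyapunov function V is the sum of |xs - x|_H^2 / 2, of
    |ys - y|_G^2 / 2, of |lambda - lams|^2 / (2 gamma) and of
    (gamma / 2) sum_(i >= 2) |v_i|^2, with v_i = sum_(j >= i) A_j (x_j - xs_j).

    The primal half ([prox_admm_step]) adds the first-order conditions of the
    block subproblems ([prox_admm_variational]).  Each coupling term has the form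
    <v_i^+ - v_(i+1)^+, v_(i+1)^+ - v_(i+1)>, which is bounded by a difference of
    consecutive values of |v_(i+1)|^2 / 2 plus |v_i^+|^2 / 2.  For i = 1 the
    latter is |A x+ - a|^2 / 2 and is cancelled by the update of the multiplier;
    for i >= 2 it is absorbed by the delta-strong convexity of the blocks, and
    this is what the value of gamma is for ([sum_tail_le]).  The linearization of
    Psi costs (Lx / 2) |x+ - x|^2, by the descent lemma.  The dual half is the
    extragradient inequality ([extragradient]); the variation of the gradient in
    y costs (Ly / 2) (|x+ - x|^2 + |yh - y|^2 + |y+ - yh|^2).  The assumptions on
    H and G say exactly that these costs are paid by the quadratic terms left by
    the proximal steps.

    Summing over the iterations and using Jensen's inequality bounds
    Phi(xbar, ys) - Phi(xs, ybar) - <lams, A xbar - a> by V_0 / T plus a term of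
    order delta ([ergodic_bound]).  Both are of order 1 / sqrt T, because 1 / gamma
    and 1 / delta are of order sqrt T.  Taking [lams] opposite to the residual, of
    norm [rho], gives the first claim ([ergodic_rate]).

    For the second claim the gap must also be bounded below.  Slater's condition
    yields a constant B such that the minimum of Phi(., y) over the feasible set is
    at most Phi(x, y) + B |A x - a| ([slater_error_bound]), so the gap at xbar is at
    least - B |A xbar - a|; the first claim with rho = B + 1 then bounds both the
    residual and the gap. *)

Set Implicit Arguments.
Unset Strict Implicit.
Unset Printing Implicit Defensive.

(** * The Euclidean inner product *)

Section InnerProduct.
Context {R : realType}.

Lemma dotE k (u v : 'cV[R]_k) : dot u v = \sum_i u i 0 * v i 0.
Proof. by rewrite /dot mxE; apply: eq_bigr => i _; rewrite mxE. Qed.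

Lemma dotC k (u v : 'cV[R]_k) : dot u v = dot v u.
Proof. by rewrite !dotE; apply: eq_bigr => i _; rewrite mulrC. Qed.

Lemma dotDr k (u v w : 'cV[R]_k) : dot u (v + w) = dot u v + dot u w.
Proof. by rewrite /dot mulmxDr mxE. Qed.

Lemma dotZr k a (u v : 'cV[R]_k) : dot u (a *: v) = a * dot u v.
Proof. by rewrite /dot -scalemxAr mxE. Qed.

Lemma dotNr k (u v : 'cV[R]_k) : dot u (- v) = - dot u v.
Proof. by rewrite -scaleN1r dotZr mulN1r. Qed.

Lemma dotDl k (u v w : 'cV[R]_k) : dot (u + v) w = dot u w + dot v w.
Proof. by rewrite dotC dotDr !(dotC w). Qed.

Lemma dotZl k a (u v : 'cV[R]_k) : dot (a *: u) v = a * dot u v.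
Proof. by rewrite dotC dotZr dotC. Qed.

Lemma dotNl k (u v : 'cV[R]_k) : dot (- u) v = - dot u v.
Proof. by rewrite dotC dotNr dotC. Qed.

Lemma dot0r k (u : 'cV[R]_k) : dot u 0 = 0.
Proof. by rewrite -(scale0r 0) dotZr mul0r. Qed.

Lemma dot0l k (u : 'cV[R]_k) : dot 0 u = 0.
Proof. by rewrite dotC dot0r. Qed.

Lemma dot_sumr k (I : Type) (r : seq I) (p : pred I) (u : 'cV[R]_k) F :
  dot u (\sum_(i <- r | p i) F i) = \sum_(i <- r | p i) dot u (F i).
Proof.
by elim/big_rec2: _ => [|i x y _ <-]; rewrite ?dot0r // dotDr.
Qed.

Lemma dot_mulmxl p q (M : 'M[R]_(p, q)) u v : dot (M *m u) v = dot u (M^T *m v).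
Proof. by rewrite /dot trmx_mul mulmxA. Qed.

Definition dotBE := (dotDl, dotDr, dotNl, dotNr, dotZl, dotZr).

Lemma dotvv_ge0 k (u : 'cV[R]_k) : 0 <= dot u u.
Proof. by rewrite dotE sumr_ge0 // => i _; rewrite -expr2 sqr_ge0. Qed.

Lemma dotvv_eq0 k (u : 'cV[R]_k) : dot u u = 0 -> u = 0.
Proof.
rewrite dotE => /eqP; rewrite psumr_eq0 => [|i _]; last by rewrite -expr2 sqr_ge0.
move=> /allP h; apply/colP => i; rewrite mxE.
have := h i (mem_index_enum _); rewrite -expr2 sqrf_eq0 /=.
by move/eqP.
Qed.

Lemma enorm_ge0 k (u : 'cV[R]_k) : 0 <= enorm u.
Proof. exact: sqrtr_ge0. Qed.

Lemma enorm_sqr k (u : 'cV[R]_k) : enorm u ^+ 2 = dot u u.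
Proof. by rewrite sqr_sqrtr // dotvv_ge0. Qed.

Lemma enorm0 k : enorm (0 : 'cV[R]_k) = 0.
Proof. by rewrite /enorm dot0r sqrtr0. Qed.

Lemma enorm_eq0 k (u : 'cV[R]_k) : enorm u = 0 -> u = 0.
Proof. by move=> h; apply: dotvv_eq0; rewrite -enorm_sqr h expr0n. Qed.

Lemma enormZ k a (u : 'cV[R]_k) : enorm (a *: u) = `|a| * enorm u.
Proof.
by rewrite /enorm dotZl dotZr mulrA -expr2 sqrtrM ?sqr_ge0 // sqrtr_sqr.
Qed.

(** The Cauchy-Schwarz inequality. *)
Lemma dot_le_enorm k (u v : 'cV[R]_k) : dot u v <= enorm u * enorm v.
Proof.
have [/eqP u0|u0] := boolP (enorm u == 0).
  by rewrite u0 mul0r (enorm_eq0 u0) dot0l.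
have u_gt0 : 0 < enorm u by rewrite lt_def u0 enorm_ge0.
(* The squared norm of |u|^2 v - <u, v> u is |u|^2 (|u|^2 |v|^2 - <u, v>^2). *)
have := dotvv_ge0 (enorm u ^+ 2 *: v - dot u v *: u).
rewrite !dotBE (dotC v u) -(enorm_sqr u) -(enorm_sqr v) => h.
have {h} h : dot u v ^+ 2 <= (enorm u * enorm v) ^+ 2.
  by rewrite -(ler_pM2l (exprn_gt0 2 u_gt0)); lra.
have := h; rewrite -ler_sqrt ?sqr_ge0 // !sqrtr_sqr.
rewrite (ger0_norm (mulr_ge0 (enorm_ge0 _) (enorm_ge0 _))).
exact/le_trans/ler_norm.
Qed.

Lemma dot2_le k (u v : 'cV[R]_k) : 2 * dot u v <= dot u u + dot v v.
Proof. by have := dotvv_ge0 (u - v); rewrite !dotBE (dotC v u); lra. Qed.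

(** Jensen's inequality for the squared norm. *)
Lemma dot_sum_le k (I : finType) (p : pred I) (F : I -> 'cV[R]_k) :
  dot (\sum_(i | p i) F i) (\sum_(i | p i) F i)
    <= #|p|%:R * \sum_(i | p i) dot (F i) (F i).
Proof.
set s := \sum_(i | p i) F i.
(* Each summand satisfies 2 c <s, F i> <= |s|^2 + c^2 |F i|^2, c being the number
   of summands; adding these gives 2 c |s|^2 <= c |s|^2 + c^2 sum |F i|^2. *)
have h i : 2 * dot s (F i) * #|p|%:R <= dot s s + #|p|%:R ^+ 2 * dot (F i) (F i).
  have := dot2_le s (#|p|%:R *: F i).
  by rewrite !dotBE; lra.
have := ler_sum (index_enum I) (P := p) (fun i _ => h i).
rewrite big_split /= -mulr_sumr -mulr_suml -mulr_sumr -dot_sumr -/s.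
rewrite sumr_const -mulr_natr => {}h.
have [/card0_eq p0|c0] := posnP #|p|.
  by rewrite /s !big_pred0 ?dot0r ?mulr0.
have c_gt0 : 0 < #|p|%:R :> R by rewrite ltr0n.
rewrite -(ler_pM2l c_gt0); lra.
Qed.

(** The Frobenius norm: a crude but explicit bound on the operator norm, from which
    the set defining the spectral norm is seen to be bounded. *)
Definition frobenius p q (M : 'M[R]_(p, q)) : R :=
  Num.sqrt (\sum_i \sum_j M i j ^+ 2).

Lemma frobenius_ge0 p q (M : 'M[R]_(p, q)) : 0 <= frobenius M.
Proof. exact: sqrtr_ge0. Qed.

Lemma enorm_mulmx p q (M : 'M[R]_(p, q)) v :
  enorm (M *m v) <= frobenius M * enorm v.
Proof.
rewrite -(@ler_pXn2r _ 2) ?nnegrE ?mulr_ge0 ?enorm_ge0 ?frobenius_ge0 //.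
rewrite exprMn [frobenius _ ^+ 2]sqr_sqrtr; last first.
  by rewrite sumr_ge0 // => i _; rewrite sumr_ge0 // => j _; rewrite sqr_ge0.
rewrite enorm_sqr dotE mulr_suml; apply: ler_sum => i _.
have -> : (M *m v) i 0 = dot (row i M)^T v.
  by rewrite mxE dotE; apply: eq_bigr => j _; rewrite !mxE.
have -> : \sum_j M i j ^+ 2 = enorm (row i M)^T ^+ 2.
  by rewrite enorm_sqr dotE; apply: eq_bigr => j _; rewrite !mxE expr2.
rewrite -exprMn -expr2 -(real_normK (num_real (dot _ _))).
rewrite ler_pXn2r ?nnegrE ?mulr_ge0 ?enorm_ge0 //.
rewrite ler_norml dot_le_enorm andbT lerNl -dotNl (le_trans (dot_le_enorm _ _)) //.
by rewrite -scaleN1r enormZ normrN1 mul1r.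
Qed.

(** The spectral norm, defined as a supremum over the unit ball, is an operator
    norm. *)
Lemma enorm_spectral p q (M : 'M[R]_(p, q)) v :
  enorm (M *m v) <= spectral_norm M * enorm v.
Proof.
have [/eqP v0|v0] := boolP (enorm v == 0).
  by rewrite (enorm_eq0 v0) mulmx0 !enorm0 mulr0.
have v_gt0 : 0 < enorm v by rewrite lt_def v0 enorm_ge0.
rewrite -ler_pdivrMr //.
have -> : enorm (M *m v) / enorm v = enorm (M *m ((enorm v)^-1 *: v)).
  by rewrite -scalemxAr enormZ ger0_norm ?invr_ge0 ?enorm_ge0 // mulrC.
apply: ub_le_sup.
  exists (frobenius M) => _ [w /= w1 <-].
  by rewrite (le_trans (enorm_mulmx _ _)) // ler_piMr ?frobenius_ge0.
exists ((enorm v)^-1 *: v) => //=.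
by rewrite enormZ ger0_norm ?invr_ge0 ?enorm_ge0 // mulVf.
Qed.

Lemma spectral_norm_gt0 p q (M : 'M[R]_(p, q)) : M != 0 -> 0 < spectral_norm M.
Proof.
move=> M0; rewrite ltNge; apply: contra M0 => M0.
apply/eqP/matrixP => i j; rewrite mxE.
have : M *m delta_mx j 0 = 0 :> 'cV_p.
  apply: enorm_eq0; apply/eqP; rewrite eq_le enorm_ge0 andbT.
  rewrite (le_trans (enorm_spectral _ _)) //.
  by rewrite mulr_le0_ge0 ?enorm_ge0.
by rewrite -colE => /matrixP/(_ i 0); rewrite !mxE.
Qed.

Lemma sqnorm_mx_le k (M : 'M[R]_k) v :
  sqnorm_mx M v <= frobenius M * enorm v ^+ 2.
Proof.
rewrite (le_trans (dot_le_enorm _ _)) // mulrC expr2 mulrA.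
by rewrite ler_wpM2r ?enorm_ge0 ?enorm_mulmx.
Qed.

Lemma dot_sqDZ k (u v : 'cV[R]_k) t :
  dot (u + t *: v) (u + t *: v)
    = dot u u + t * (2 * dot v u) + t ^+ 2 * dot v v.
Proof. by rewrite !dotBE (dotC u v); ring. Qed.

Lemma sqnorm_mxDZ k (M : 'M[R]_k) u v t : M^T = M ->
  sqnorm_mx M (u + t *: v)
    = sqnorm_mx M u + t * (2 * dot v (M *m u)) + t ^+ 2 * sqnorm_mx M v.
Proof.
move=> symM; rewrite /sqnorm_mx mulmxDr -scalemxAr !dotBE.
have -> : dot u (M *m v) = dot v (M *m u) by rewrite dotC dot_mulmxl symM.
ring.
Qed.

Lemma three_points k (M : 'M[R]_k) (w p x : 'cV[R]_k) : M^T = M ->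
  2 * dot (w - p) (M *m (p - x))
    = sqnorm_mx M (w - x) - sqnorm_mx M (w - p) - sqnorm_mx M (p - x).
Proof.
move=> symM; have := sqnorm_mxDZ (p - x) (w - p) 1 symM.
have -> : p - x + 1 *: (w - p) = w - x by rewrite scale1r addrC subrKA.
move=> ->; ring.
Qed.

(** The Loewner inequality M >= c I in terms of quadratic forms. *)
Lemma psd_sub_scalar k (M : 'M[R]_k) c v :
  psd (M - c%:M) -> c * dot v v <= sqnorm_mx M v.
Proof.
move=> [_ /(_ v)]; rewrite /sqnorm_mx mulmxBl mul_scalar_mx !dotBE subr_ge0.
by [].
Qed.

Lemma pd_ge0 k (M : 'M[R]_k) v : pd M -> 0 <= sqnorm_mx M v.
Proof.
move=> [_ posM]; have [->|v0] := eqVneq v 0; last exact/ltW/posM.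
by rewrite /sqnorm_mx dot0l.
Qed.

Lemma pd_unitmx k (M : 'M[R]_k) : pd M -> M \in unitmx.
Proof.
move=> [symM posM]; rewrite -row_free_unit; apply: inj_row_free => v vM.
apply/eqP; rewrite -[_ == 0]negbK; apply/negP => v0.
have /posM : v^T != 0 by rewrite -(inj_eq trmx_inj) trmxK trmx0.
by rewrite /sqnorm_mx -{1}symM -trmx_mul vM trmx0 dot0r ltxx.
Qed.

End InnerProduct.

(** * Convex functions and their minimizers *)

Section Convexity.
Context {R : realType}.

Lemma convex_setP k (D : set 'cV[R]_k) x y t :
  convex_set D -> D x -> D y -> 0 <= t <= 1 -> D (x + t *: (y - x)).
Proof.
move=> cD Dx Dy /andP[t0 t1].
have := cD y x (Itv01 t0 t1) (mem_set Dy) (mem_set Dx).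
rewrite inE; congr D; rewrite /conv /= /unstable.onem scalerBl scale1r scalerBr.
by rewrite addrCA.
Qed.

Lemma convex_functionP k (D : set 'cV[R]_k) (f : 'cV[R]_k -> R) x y t :
  convex_function D f -> D x -> D y -> 0 <= t <= 1 ->
  f (x + t *: (y - x)) <= f x + t * (f y - f x).
Proof.
move=> cf Dx Dy /andP[t0 t1].
have := cf (Itv01 t0 t1) y x (mem_set Dy) (mem_set Dx).
rewrite convRE /= /unstable.onem.
have -> : conv (Itv01 t0 t1) (y : convex_lmodType 'cV[R]_k) x = x + t *: (y - x).
  by rewrite /conv /= /unstable.onem scalerBl scale1r scalerBr addrCA.
by move=> /le_trans; apply; rewrite le_eqVlt; apply/orP; left; apply/eqP; ring.
Qed.

(** Jensen's inequality for the average of finitely many points. *)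
Lemma convex_mean k (D : set 'cV[R]_k) (f : 'cV[R]_k -> R) (u : nat -> 'cV[R]_k) T :
  convex_set D -> convex_function D f -> (forall i, D (u i)) ->
  let m := T.+1%:R^-1 *: \sum_(i < T.+1) u i in
  D m /\ f m <= T.+1%:R^-1 * \sum_(i < T.+1) f (u i).
Proof.
move=> cD cf Du; elim: T => [|T [Dm fm]].
  by rewrite /= invr1 scale1r mul1r !big_ord1.
set m := _^-1 *: _ in Dm fm.
pose t : R := T.+2%:R^-1.
have t01 : 0 <= t <= 1.
  by rewrite invr_ge0 ler0n /= invf_le1 ?ltr0n // ler1n.
have TT : T.+1%:R = T.+2%:R - 1 :> R by rewrite -[T.+2]addn1 natrD addrK.
have T2 : T.+2%:R != 0 :> R by rewrite pnatr_eq0.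
have T1 : T.+1%:R != 0 :> R by rewrite pnatr_eq0.
(* The new mean is the point of the segment from the old mean to [u T.+1] at
   parameter [t]. *)
have E : T.+2%:R^-1 *: \sum_(i < T.+2) u i = m + t *: (u T.+1 - m).
  rewrite big_ord_recr /= scalerDr scalerBr addrCA addrC; congr (_ + _).
  rewrite -[X in X - _]scale1r -scalerBl /m scalerA; congr (_ *: _).
  rewrite /t; move: TT T2 T1; set a := T.+1%:R; set b := T.+2%:R => -> *.
  by field; apply/andP.
rewrite E; split; first exact: convex_setP.
apply: le_trans (convex_functionP cf Dm (Du T.+1) t01) _.
rewrite -/t [in leRHS]big_ord_recr /= [in leRHS]mulrDr.
have -> : f m + t * (f (u T.+1) - f m) = (1 - t) * f m + t * f (u T.+1) by ring.
rewrite lerD2r.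
have -> : t * \sum_(i < T.+1) f (u i)
    = (1 - t) * (T.+1%:R^-1 * \sum_(i < T.+1) f (u i)).
  rewrite mulrA; congr (_ * _).
  rewrite /t; move: TT T2 T1; set a := T.+1%:R; set b := T.+2%:R => -> *.
  by field; apply/andP.
by rewrite ler_wpM2l // subr_ge0; case/andP: t01.
Qed.

Lemma ge0_of_linear_perturbation (a s : R) :
  (forall t, 0 < t <= 1 -> 0 <= a + t * s) -> 0 <= a.
Proof.
move=> h; rewrite leNgt; apply/negP => a0.
(* For this t the correction t * s is at most - a / 2. *)
pose t := Num.min 1 (- a / (2 * (`|s| + 1))).
have s1 : 0 < 2 * (`|s| + 1) by rewrite mulr_gt0 // ltr_wpDl.
have t0 : 0 < t by rewrite lt_min ltr01 /= divr_gt0 // oppr_gt0.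
have t1 : t <= 1 by rewrite ge_min lexx.
have := h t; rewrite t0 t1 => /(_ isT).
apply/negP; rewrite -ltNge.
have ts : t * (2 * (`|s| + 1)) <= - a.
  by rewrite -ler_pdivlMr // ge_min lexx orbT.
have : t * s <= t * `|s| by rewrite ler_wpM2l ?(ltW t0) // ler_norm.
have := mulr_ge0 (ltW t0) (normr_ge0 s).
lra.
Qed.

(** First-order optimality of a minimizer [p] of the sum of a convex function
    [f] and of a quadratic function [q], tested in the direction of [w]: [l] is
    the directional derivative of [q] at [p]. *)
Lemma argmin_variational k (D : set 'cV[R]_k) (f q : 'cV[R]_k -> R) p w l s :
  convex_set D -> convex_function D f -> D p -> D w ->
  (forall w', D w' -> f p + q p <= f w' + q w') ->
  (forall t, q (p + t *: (w - p)) = q p + t * l + t ^+ 2 * s) ->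
  0 <= f w - f p + l.
Proof.
move=> cD cf Dp Dw pmin qE; apply: (@ge0_of_linear_perturbation _ s) => t /andP[t0 t1].
have t01 : 0 <= t <= 1 by rewrite (ltW t0).
have := pmin _ (convex_setP cD Dp Dw t01).
have := convex_functionP cf Dp Dw t01; rewrite qE => h1 h2.
rewrite -(pmulr_rge0 _ t0); move: h1 h2; set F := f (_ + _).
move=> h1 h2; lra.
Qed.

(** The subgradient inequality for the gradient relative to a convex set. *)
Lemma convex_grad_on k (D : set 'cV[R]_k) (f : 'cV[R]_k -> R) x g z :
  convex_set D -> convex_function D f -> is_grad_on D f x g -> D x -> D z ->
  f x + dot g (z - x) <= f z.
Proof.
move=> cD cf fg Dx Dz.
have [->|zx] := eqVneq z x; first by rewrite subrr dot0r addr0.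
set c := z - x; have c0 : c != 0 by rewrite subr_eq0.
have nc : 0 < enorm c.
  by rewrite lt_def enorm_ge0 andbT; apply: contra c0 => /eqP/enorm_eq0 ->.
(* Convexity bounds the difference quotient defining [g], taken at x + t c, by its
   value at z; as it tends to 0 with t, the value at z is nonnegative. *)
suff : 0 <= (f z - f x - dot g c) / enorm c.
  by rewrite pmulr_lge0 ?invr_gt0 //; lra.
rewrite leNgt; apply/negP => h.
set e := (_ / _) in h *.
move/cvgrPdist_lt: fg => /(_ (- e)).
rewrite oppr_gt0 => /(_ h).
rewrite /dnbhs /within /= => H.
have cont : (fun t : R => x + t *: c) @ (0 : R) --> x + (0 : R) *: c.
  by apply: cvgD; [exact: cvg_cst|apply: cvgZr_tmp; exact: cvg_id].
rewrite scale0r addr0 in cont.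
have := cont _ H; rewrite /= => /nbhs_ballP[r /= r0 rP].
pose t : R := Num.min 1 (r / 2).
have t0 : 0 < t by rewrite lt_min ltr01 /= divr_gt0.
have t1 : t <= 1 by rewrite ge_min lexx.
have t01 : 0 <= t <= 1 by rewrite (ltW t0).
have xt : x + t *: c - x = t *: c by rewrite addrC addKr.
have := rP t.
rewrite -ball_normE /= sub0r normrN gtr0_norm // => {}rP.
have {}/rP : t < r.
  have : t <= r / 2 by rewrite ge_min lexx orbT.
  by have : 0 < r by []; lra.
have -> : x + t *: c != x.
  by rewrite -subr_eq0 xt scaler_eq0 negb_or c0 gt_eqF.
move=> /(_ isT (convex_setP cD Dx Dz t01)).
rewrite sub0r normrN xt enormZ dotZr (gtr0_norm t0).
apply/negP; rewrite -leNgt.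
have fe : f z - f x - dot g c = e * enorm c by rewrite /e divfK // gt_eqF.
have q : (f (x + t *: c) - f x - t * dot g c) / (t * enorm c) <= e.
  rewrite ler_pdivrMr ?mulr_gt0 // mulrCA -fe.
  by have := convex_functionP cf Dx Dz t01; rewrite -/c; lra.
rewrite ler0_norm; first by rewrite lerN2.
exact: le_trans q (ltW h).
Qed.

Lemma le0_of_archimedean (a b : R) : (forall n, n.+1%:R * a <= b) -> a <= 0.
Proof.
move=> h; rewrite leNgt; apply/negP => a0.
have := h (Num.truncn (b / a)); rewrite -ler_pdivlMr //.
by rewrite leNgt truncnS_gt.
Qed.

(** The descent lemma for a convex function with a Lipschitz gradient.  The
    segment from [x] to [y] is cut into [n] pieces; on each of them the
    subgradient inequality at the far end point bounds the increase of [f], and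
    the sum of these bounds tends to the stated one when [n] grows.  No sign
    condition on [L] is needed. *)
Lemma descent_lemma k (D : set 'cV[R]_k) (f : 'cV[R]_k -> R) gr L x y :
  convex_set D -> convex_function D f ->
  (forall u, D u -> is_grad_on D f u (gr u)) ->
  (forall u v, D u -> D v -> enorm (gr u - gr v) <= L * enorm (u - v)) ->
  D x -> D y ->
  f y <= f x + dot (gr x) (y - x) + L / 2 * dot (y - x) (y - x).
Proof.
move=> cD cf fgr lipL Dx Dy; set c := y - x.
(* With n + 1 pieces the bound holds up to an error L |c|^2 / (2 (n + 1)). *)
rewrite -subr_le0; apply: (@le0_of_archimedean _ (L / 2 * dot c c)) => n.
pose h : R := n.+1%:R^-1.
have n0 : n.+1%:R != 0 :> R by rewrite pnatr_eq0.
have h0 : 0 < h by rewrite invr_gt0 ltr0n.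
pose u j := x + (j%:R * h) *: c.
have j01 j : (j <= n.+1)%N -> 0 <= j%:R * h <= 1.
  by move=> jn; rewrite mulr_ge0 ?(ltW h0) //= ler_pdivrMr ?ltr0n // mul1r ler_nat.
have Du j : (j <= n.+1)%N -> D (u j).
  by move=> jn; apply: convex_setP => //; exact: j01.
have step j : (j < n.+1)%N ->
    f (u j.+1) <= f (u j) + h * dot (gr x) c + h ^+ 2 * j.+1%:R * (L * dot c c).
  move=> jn; have uu : u j - u j.+1 = - h *: c.
    rewrite /u opprD addrACA subrr add0r -scalerBl -mulrBl.
    by rewrite -[in j.+1%:R]addn1 natrD opprD addrA subrr sub0r mulN1r.
  have := convex_grad_on cD cf (fgr _ (Du _ jn)) (Du _ jn) (Du _ (ltnW jn)).
  rewrite uu dotZr => h1.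
  have h2 : dot (gr (u j.+1) - gr x) c <= L * (j.+1%:R * h * dot c c).
    apply: le_trans (dot_le_enorm _ _) _.
    apply: le_trans (ler_wpM2r (enorm_ge0 _) (lipL _ _ (Du _ jn) Dx)) _.
    rewrite [u _ - x]addrC addKr enormZ -enorm_sqr.
    by rewrite ger0_norm ?(andP (j01 _ jn)).1 // expr2 !mulrA.
  have := ler_wpM2l (ltW h0) h2; rewrite dotDl dotNl => {}h2.
  set U := f (u j.+1) in h1 *; set V := f (u j) in h1 *.
  move: h1 h2; set a := dot (gr (u j.+1)) c; set b := dot (gr x) c.
  move=> h1 h2; nra.
have sums j : (j <= n.+1)%N -> f (u j) <= f x + j%:R * h * dot (gr x) c
    + h ^+ 2 * (j%:R * (j%:R + 1) / 2) * (L * dot c c).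
  elim: j => [|j IH] jn.
    by rewrite /u !mul0r scale0r addr0 mulr0 !mul0r !addr0.
  apply: le_trans (step j jn) _.
  have := IH (ltnW jn); set V := f (u j) => hV.
  rewrite -[j.+1]addn1 natrD; move: hV; set J := j%:R => hV.
  rewrite [leRHS](_ : _ =
    (f x + J * h * dot (gr x) c + h ^+ 2 * (J * (J + 1) / 2) * (L * dot c c))
    + h * dot (gr x) c + h ^+ 2 * (J + 1) * (L * dot c c)); last by field.
  by rewrite !lerD2r.
have := sums _ (leqnn _); rewrite {1}/u {1 2}/h mulfV // scale1r subrKC mul1r.
move=> hy.
have n1 : 0 < n.+1%:R :> R by rewrite ltr0n.
have {}hy := ler_wpM2l (ltW n1) hy.
have E : n.+1%:R * (h ^+ 2 * (n.+1%:R * (n.+1%:R + 1) / 2) * (L * dot c c)) =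
   (n.+1%:R + 1) / 2 * (L * dot c c).
  by rewrite /h; field.
move: hy; rewrite [in X in _ <= X]mulrDr E; set nn := n.+1%:R.
set F := f y; set F0 := f x; set dd := dot c c; set gg := dot _ c.
by move=> hy; lra.
Qed.

End Convexity.

(** * Existence of minimizers *)

Section Minimizers.
Context {R : realType}.

Lemma lsc_on_cst k (D : set 'cV[R]_k) a : lsc_on D (fun=> a).
Proof. by move=> x b bx; exists setT => //; exact: filterT. Qed.

Lemma lsc_on_near k (D : set 'cV[R]_k) (f : 'cV[R]_k -> R) p a :
  lsc_on D f -> D p -> a < f p -> \forall w \near p, D w -> a < f w.
Proof.
move=> lf Dp ap; have [|V] := lf p a; first by rewrite lte_fin.
rewrite /nbhs /= -nbhs_subspace_in // => Vp aV.
move: Vp; rewrite /within /=; apply: filterS => w Vw Dw.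
by have := aV _ (Vw Dw); rewrite lte_fin.
Qed.

(** Weierstrass's theorem: the sublevel sets of [F] generate a filter on [D], and lower
    semicontinuity makes any cluster point of it a minimizer. *)
Lemma compact_lsc_min k (D : set 'cV[R]_k) (F : 'cV[R]_k -> R) :
  compact D -> D !=set0 ->
  (forall p a, D p -> a < F p -> \forall w \near p, D w -> a < F w) ->
  exists p, D p /\ forall w, D w -> F p <= F w.
Proof.
move=> cD D0 lF.
pose S w0 := [set w | D w /\ F w <= F w0].
have FF : Filter (filter_from D S).
  apply: filter_from_filter => // w1 w2 D1 D2.
  case/orP: (le_total (F w1) (F w2)) => le12.
    by exists w1 => // w [Dw ww]; do !split=> //; exact: le_trans ww le12.
  by exists w2 => // w [Dw ww]; do !split=> //; exact: le_trans ww le12.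
have PF : ProperFilter (filter_from D S).
  by apply: filter_from_proper => w Dw; exists w; split.
have [|p [Dp clp]] := cD _ PF.
  by have [w Dw] := D0; exists w => // ? [].
exists p; split=> // w Dw; rewrite leNgt; apply/negP => /(lF _ _ Dp) near_p.
have [|v [[Dv vw] /(_ Dv)]] := clp (S w) _ _ near_p; first by exists w.
by rewrite ltNge vw.
Qed.

Lemma argminP k (D : set 'cV[R]_k) (F : 'cV[R]_k -> R) :
  (exists p, D p /\ forall w, D w -> F p <= F w) ->
  D (argmin D F) /\ forall w, D w -> F (argmin D F) <= F w.
Proof. by move=> [p pmin]; rewrite /argmin; case: xgetP => [w _ //|/(_ p)]. Qed.

Lemma fct_addr_continuous k (f g : 'cV[R]_k -> R) :
  continuous f -> continuous g -> continuous (fun w => f w + g w).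
Proof. by move=> cf cg w; apply: continuousD; [exact: cf|exact: cg]. Qed.

Lemma fct_scaler_continuous k a (f : 'cV[R]_k -> R) :
  continuous f -> continuous (fun w => a * f w).
Proof. by move=> cf w; apply: continuousM; [exact: cst_continuous|exact: cf]. Qed.

Lemma sum_continuous k (I : Type) (r : seq I) (F : I -> 'cV[R]_k -> R) :
  (forall i, continuous (F i)) -> continuous (fun w => \sum_(i <- r) F i w).
Proof.
move=> cF; elim: r => [|i r IH].
  have -> : (fun w => \sum_(i <- [::]) F i w) = fun=> 0.
    by apply/funext => w'; rewrite big_nil.
  exact: cst_continuous.
have -> : (fun w => \sum_(j <- i :: r) F j w) = F i \+ fun w => \sum_(j <- r) F j w.
  by apply/funext => w'; rewrite big_cons.
by move=> w; apply: continuousD; [exact: cF|exact: IH].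
Qed.

Lemma dot_continuous k p (u v : 'cV[R]_k -> 'cV[R]_p) :
  (forall i, continuous (fun w => u w i 0)) ->
  (forall i, continuous (fun w => v w i 0)) ->
  continuous (fun w => dot (u w) (v w)).
Proof.
move=> cu cv.
have -> : (fun w => dot (u w) (v w)) = fun w => \sum_i u w i 0 * v w i 0.
  by apply/funext => w; rewrite dotE.
by apply: sum_continuous => i w; apply: continuousM; [exact: cu|exact: cv].
Qed.

Lemma affine_continuous k p (A : 'M[R]_(p, k)) (b : 'cV[R]_p) i :
  continuous (fun w : 'cV[R]_k => (A *m w + b) i 0).
Proof.
have -> : (fun w => (A *m w + b) i 0) = fun w => \sum_j A i j * w j 0 + b i 0.
  by apply/funext => w; rewrite 2!mxE.
move=> w; apply: continuousD; last exact: cst_continuous.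
apply: sum_continuous => j {}w.
by apply: continuousM; [exact: cst_continuous|exact: coord_continuous].
Qed.

(** The sum of a lower semicontinuous function and of a continuous one attains its
    minimum on a compact set, so that [argmin] is one of its minimizers. *)
Lemma argmin_lscD k (D : set 'cV[R]_k) (f q : 'cV[R]_k -> R) :
  compact D -> D !=set0 -> lsc_on D f -> continuous q ->
  let p := argmin D (fun w => f w + q w) in
  D p /\ forall w, D w -> f p + q p <= f w + q w.
Proof.
move=> cD D0 lf cq; apply: argminP; apply: compact_lsc_min => // p a Dp apq.
pose e := (f p + q p - a) / 2.
have e0 : 0 < e by rewrite divr_gt0 // subr_gt0.
have : \forall w \near p, q p - e < q w by apply: (cvgr_gt _ (cq p)); lra.
have : f p - e < f p by lra.
move=> /(lsc_on_near lf Dp); apply: filterS2 => w fw qw Dw.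
have := fw Dw; rewrite /e; move: qw; rewrite /e; lra.
Qed.

End Minimizers.

(** * Block vectors and the block updates *)

Section Blocks.
Context {R : realType} {N m n : nat} {d : 'I_N -> nat}.
Implicit Types (P : problem R d m n) (x z : 'cV[R]_(\sum_i d i)).

Lemma blk_set_blk x i (w : 'cV[R]_(d i)) : blk (set_blk x w) i = w.
Proof. by rewrite /blk mxcolK dfwithin. Qed.

Lemma blk_set_blk_neq x i j (w : 'cV[R]_(d i)) :
  i != j -> blk (set_blk x w) j = blk x j.
Proof. by move=> ij; rewrite /blk mxcolK dfwithout. Qed.

Lemma blkD x z i : blk (x + z) i = blk x i + blk z i.
Proof. exact: submxcolD. Qed.

Lemma blkB x z i : blk (x - z) i = blk x i - blk z i.
Proof. exact: submxcolB. Qed.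

Lemma blkZ a x i : blk (a *: x) i = a *: blk x i.
Proof. by apply/matrixP => j k; rewrite !mxE. Qed.

Lemma dot_blk x z : dot x z = \sum_i dot (blk x i) (blk z i).
Proof.
rewrite /dot -{1}[x]submxcolK -{1}[z]submxcolK tr_mxcol mul_mxrow_mxcol.
by rewrite summxE.
Qed.

Lemma Amx_blk P x : Amx P *m x = \sum_i Ablk P i *m blk x i.
Proof. by rewrite /Amx -{1}[x]submxcolK mul_mxrow_mxcol. Qed.

Lemma Xset_convex P : compact_convex_sets P -> convex_set (Xset P).
Proof.
move=> [_ cX _ _] x y t; rewrite !inE => Xx Xy i.
have := cX i (blk x i) (blk y i) t; rewrite !inE => /(_ (Xx i) (Xy i)).
by congr (Xblk P i); rewrite /conv /= blkD !blkZ.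
Qed.

Section ProxAdmm.
Variables (Q : problem R d m n) (gamma : R) (H : forall i, 'M[R]_(d i)).
Variables (x : 'cV[R]_(\sum_i d i)) (lam : 'cV[R]_n) (y : 'cV[R]_m).
Let pb := prox_block Q gamma H x lam y.

Lemma blk_prox_block_neq z i j : i != j -> blk (pb z i) j = blk z j.
Proof. exact: blk_set_blk_neq. Qed.

Lemma blk_foldl_notin s z j : j \notin s -> blk (foldl pb z s) j = blk z j.
Proof.
elim: s z => //= i s IH z; rewrite inE negb_or => /andP[ij js].
by rewrite IH // blk_prox_block_neq // eq_sym.
Qed.

(** The [i]-th block of the output is computed at a point [z] whose blocks
    before [i] are those of the output and whose other blocks are those of the
    input. *)
Lemma prox_admm_blk i : let xp := (prox_admm Q gamma H x lam y).1 in
  exists z, [/\ blk xp i = blk (pb z i) i,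
    forall j : 'I_N, (j < i)%N -> blk z j = blk xp j &
    forall j : 'I_N, (i <= j)%N -> blk z j = blk x j].
Proof.
move=> xp; set s := enum 'I_N.
have ui : uniq s by exact: enum_uniq.
have is_ : i \in s by rewrite mem_enum.
have idx j : index j s = j by exact: index_enum_ord.
have tk (j : 'I_N) : (j \in take i s) = (j < i)%N.
  by rewrite in_take ?idx // mem_enum.
have sE : s = take i s ++ i :: drop i.+1 s.
  rewrite -{1}(cat_take_drop i s) (drop_nth i) ?size_enum_ord //.
  by rewrite -{2}(idx i) nth_index.
pose z := foldl pb x (take i s); exists z.
have xpE : xp = foldl pb (pb z i) (drop i.+1 s).
  by rewrite /xp /prox_admm /= -/s [in LHS]sE foldl_cat.
move: ui; rewrite sE cat_uniq /= => /and3P[_ /norP[_ hd] /andP[idrop _]].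
split=> [|j ji|j ij].
- by rewrite xpE blk_foldl_notin.
- rewrite xpE blk_foldl_notin; last first.
    by apply: contra hd => jd; apply/hasP; exists j => //=; rewrite tk.
  by rewrite blk_prox_block_neq // -val_eqE /= gtn_eqF.
- by rewrite /z blk_foldl_notin // tk -leqNgt.
Qed.

End ProxAdmm.

(** The contribution to [A x] of the blocks of index at least [k]. *)
Definition tail P k x : 'cV[R]_n := \sum_(j < N | (k <= j)%N) Ablk P j *m blk x j.

Lemma tail0 P x : tail P 0 x = Amx P *m x.
Proof. by rewrite /tail Amx_blk; apply: eq_bigl => j. Qed.

Lemma tailN P x : tail P N x = 0.
Proof. by rewrite /tail big_pred0 // => j; rewrite leqNgt ltn_ord. Qed.

Lemma tailS P (i : 'I_N) x : tail P i x = Ablk P i *m blk x i + tail P i.+1 x.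
Proof.
rewrite /tail (bigD1 i) //=; congr (_ + _); apply: eq_bigl => j.
by rewrite [RHS]ltn_neqAle andbC eq_sym.
Qed.

Lemma tailB P k x z : tail P k (x - z) = tail P k x - tail P k z.
Proof.
by rewrite /tail -sumrB; apply: eq_bigr => j _; rewrite blkB mulmxBr.
Qed.

(** The weight of the proximal term added to the block [i]: the first block, of
    index 0, is not perturbed. *)
Definition bweight (delta : R) (i : 'I_N) := if (0 < i)%N then delta else 0.

(** First-order optimality of the [i]-th block [p] of the Prox-ADMM step for the
    perturbed problem, tested against [w].  The argument of the augmented term is
    the residual at the point whose blocks up to [i] are new and whose blocks after
    [i] are old. *)
Lemma prox_admm_variational P delta x0 gamma H x lam y i (w : 'cV[R]_(d i)) :
  let Q := perturbed P delta x0 in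
  let xp := (prox_admm Q gamma H x lam y).1 in
  let p := blk xp i in
  compact (Xblk P i) -> convex_set (Xblk P i) ->
  convex_function (Xblk P i) (fun w => hfun P i w y) ->
  lsc_on (Xblk P i) (fun w => hfun P i w y) ->
  (H i)^T = H i -> Xblk P i w ->
  Xblk P i p /\
  0 <= hfun P i w y - hfun P i p y
    + (bweight delta i * dot (w - p) (p - blk x0 i)
    + dot (w - p) (blk (gradx_Psi P x y) i) - dot lam (Ablk P i *m (w - p))
    + gamma * dot (Ablk P i *m (w - p))
        (residual P xp - tail P i.+1 xp + tail P i.+1 x)
    + dot (w - p) (H i *m (p - blk x i))).
Proof.
move=> Q xp p Xc Xcv hcv hlsc symH Xw.
have [z [pE zlt zge]] := prox_admm_blk Q gamma H x lam y i.
rewrite -/xp -/p in pE zlt.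
set g := gradx_Psi P x y; set e := bweight delta i.
(* As a function of the block w the objective is h_i(w, y) + q w, where [r] is the
   part of the residual and [C] the part of the objective not depending on w. *)
pose r := \sum_(j < N | j != i) Ablk P j *m blk z j - avec P.
pose C := \sum_(j < N | j != i) hfun Q j (blk z j) y
  + \sum_(j < N | j != i) dot (blk g j) (blk z j) - dot g x - dot lam r.
pose q (w : 'cV[R]_(d i)) := C
   + (e / 2 * dot (w - blk x0 i) (w - blk x0 i) + dot (blk g i) w
   - dot lam (Ablk P i *m w)
   + gamma / 2 * dot (Ablk P i *m w + r) (Ablk P i *m w + r)
   + 2^-1 * dot (w - blk x i) (H i *m (w - blk x i))).
have resE w' : residual Q (set_blk z w') = Ablk P i *m w' + r.
  rewrite /residual Amx_blk (bigD1 i) //= blk_set_blk /r addrA; congr (_ + _ - _).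
  by apply: eq_bigr => j ji; rewrite blk_set_blk_neq // eq_sym.
have FE : (fun w => lin_aug_lagrangian Q gamma (set_blk z w) lam x y
    + 2^-1 * sqnorm_mx (H i) (w - blk x i)) = (fun w => hfun P i w y + q w).
  apply/funext => w'; rewrite /lin_aug_lagrangian resE enorm_sqr.
  rewrite (bigD1 i) //= blk_set_blk.
  have -> : \sum_(j < N | j != i) (hfun P j (blk (set_blk z w') j) y +
     (if (0 < j)%N then delta / 2 * enorm (blk (set_blk z w') j - blk x0 j) ^+ 2
      else 0))
     = \sum_(j < N | j != i) hfun Q j (blk z j) y.
    by apply: eq_bigr => j ji; rewrite blk_set_blk_neq // eq_sym.
  have -> : dot (gradx_Psi Q x y) (set_blk z w' - x) = dot (blk g i) w'
     + \sum_(j < N | j != i) dot (blk g j) (blk z j) - dot g x.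
    rewrite dotDr dotNr dot_blk (bigD1 i) //= blk_set_blk; congr (_ + _ - _).
    by apply: eq_bigr => j ji; rewrite blk_set_blk_neq // eq_sym.
  have -> : (if (0 < i)%N then delta / 2 * enorm (w' - blk x0 i) ^+ 2 else 0)
     = e / 2 * dot (w' - blk x0 i) (w' - blk x0 i).
    by rewrite enorm_sqr /e /bweight; case: ifP => _ //; rewrite !mul0r.
  rewrite /q /C /sqnorm_mx [dot lam (_ + r)]dotDr; ring.
have cont : continuous q.
  pose D k (A A' : 'M[R]_(k, d i)) (b b' : 'cV[R]_k) (w : 'cV[R]_(d i)) :=
    dot (A *m w + b) (A' *m w + b').
  have cD (a : R) k (A A' : 'M[R]_(k, d i)) b b' :
      continuous (fun w => a * D k A A' b b' w).
    apply: fct_scaler_continuous.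
    by apply: dot_continuous => j; exact: affine_continuous.
  have -> : q = fun w => C + (e / 2 * D _ 1%:M 1%:M (- blk x0 i) (- blk x0 i) w
      + 1 * D _ 0 1%:M (blk g i) 0 w + -1 * D _ 0 (Ablk P i) lam 0 w
      + gamma / 2 * D _ (Ablk P i) (Ablk P i) r r w
      + 2^-1 * D _ 1%:M (H i) (- blk x i) (- (H i *m blk x i)) w).
    apply/funext => w'; rewrite /q /D !(mul1mx, mul0mx, add0r, addr0) mulmxBr.
    by ring.
  apply: (fct_addr_continuous (f := fun=> C)); first exact: cst_continuous.
  by do !apply: fct_addr_continuous; exact: cD.
have := argmin_lscD Xc (ex_intro _ w Xw) hlsc cont.
rewrite -FE; move: pE; rewrite /prox_block blk_set_blk => <- [Xp /= pmin].
split=> //.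
have -> : residual P xp - tail P i.+1 xp + tail P i.+1 x = Ablk P i *m p + r.
  have zE : \sum_(j < N | j != i) Ablk P j *m blk z j =
      \sum_(j < N | (j < i)%N) Ablk P j *m blk xp j + tail P i.+1 x.
    rewrite (bigID (fun j : 'I_N => (j < i)%N)) /=; congr (_ + _).
      apply: eq_big => [j|j /andP[_ ji]]; last by rewrite zlt.
      by rewrite andbC; case: ltnP => //= ji; rewrite -val_eqE /= ltn_eqF.
    apply: eq_big => [j|j /andP[_ ji]]; last by rewrite zge // leqNgt.
    by rewrite -leqNgt [RHS]ltn_neqAle eq_sym.
  have xpE : Amx P *m xp = \sum_(j < N | (j < i)%N) Ablk P j *m blk xp j
      + Ablk P i *m p + tail P i.+1 xp.
    rewrite -tail0 /tail (bigID (fun j : 'I_N => (j < i)%N)) /= -addrA.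
    congr (_ + _); rewrite -/(tail _ _ _) -tailS /tail; apply: eq_bigl => j.
    by rewrite -leqNgt.
  rewrite /residual /r zE xpE.
  set a := \sum_(j < N | _) _; set b := Ablk P i *m p; set t := tail _ _ _.
  by apply/colP => k; rewrite !mxE; ring.
apply: (argmin_variational Xcv hcv Xp Xw pmin) => t.
set c := w - p.
pose l : R := e * dot c (p - blk x0 i) + dot c (blk g i) - dot lam (Ablk P i *m c)
  + gamma * dot (Ablk P i *m c) (Ablk P i *m p + r)
  + dot c (H i *m (p - blk x i)).
pose s := e / 2 * dot c c + gamma / 2 * dot (Ablk P i *m c) (Ablk P i *m c)
  + 2^-1 * sqnorm_mx (H i) c.
have -> : q (p + t *: c) = q p + t * l + t ^+ 2 * s; last by reflexivity.
have E b : p + t *: c - b = (p - b) + t *: c by rewrite addrAC.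
have Er : Ablk P i *m (p + t *: c) + r = (Ablk P i *m p + r) + t *: (Ablk P i *m c).
  by rewrite mulmxDr -scalemxAr addrAC.
have EA : Ablk P i *m (p + t *: c) = Ablk P i *m p + t *: (Ablk P i *m c).
  by rewrite mulmxDr -scalemxAr.
rewrite /q Er !E !dot_sqDZ EA -!/(sqnorm_mx _ _) sqnorm_mxDZ // /l /s.
rewrite (dotC c (blk g i)) [dot (blk g i) (_ + _)]dotDr [dot lam (_ + _)]dotDr !dotZr.
by field.
Qed.

End Blocks.

(** * One Prox-ADMM step *)

Lemma grad_onP (R : realType) k (D : set 'cV[R]_k) f x :
  differentiable_on D f -> D x -> is_grad_on D f x (grad_on D f x).
Proof. by move=> df Dx; exact: xgetPex (df x Dx). Qed.

Section ProxAdmmStep.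
Context {R : realType} {N m n : nat} {d : 'I_N -> nat}.
Variables (P : problem R d m n) (gamma delta K Lx : R) (H : forall i, 'M[R]_(d i)).
Implicit Types (x z : 'cV[R]_(\sum_i d i)).

(** The squared norm of a block vector for the metric Diag(H_1, ..., H_N). *)
Definition sqnorm_blk x : R := \sum_i sqnorm_mx (H i) (blk x i).

(** The part of the Lyapunov function carried by the primal variable [x] and the
    multiplier [lam], relative to a feasible point [xs] and an arbitrary
    multiplier [lams].  The tails are those starting at the second block or later;
    the last one, of index [N], is 0. *)
Definition lyapunov_admm xs lams x (lam : 'cV[R]_n) : R :=
  2^-1 * sqnorm_blk (xs - x) + (2 * gamma)^-1 * dot (lam - lams) (lam - lams)
  + gamma / 2 * \sum_(i < N) dot (tail P i.+1 (x - xs)) (tail P i.+1 (x - xs)).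

Lemma dot_four_points k (a b c : 'cV[R]_k) :
  2 * dot (a - b) (b - c) <= dot c c - dot b b + dot a a.
Proof.
have := dotvv_ge0 (a - b + c); rewrite !dotBE (dotC b a) (dotC c a) (dotC c b).
lra.
Qed.

Lemma residual_feasible xs z :
  Amx P *m xs = avec P -> residual P z = tail P 0 (z - xs).
Proof. by move=> feas; rewrite tail0 mulmxBr feas. Qed.

(** The tails not containing the first block are controlled by the perturbation
    weights of the other blocks: each of these at most N - 1 tails is a sum of at
    most N - 1 terms A_j z_j with |A_j z_j|^2 <= K |z_j|^2. *)
Lemma sum_tail_le z : 0 <= gamma ->
  (forall i : 'I_N, (0 < i)%N -> forall v,
     dot (Ablk P i *m v) (Ablk P i *m v) <= K * dot v v) ->
  gamma * (N.-1%:R ^+ 2 * K) <= delta -> 0 <= K ->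
  gamma * \sum_(i < N) dot (tail P i z) (tail P i z)
    <= gamma * dot (tail P 0 z) (tail P 0 z)
       + \sum_i bweight delta i * dot (blk z i) (blk z i).
Proof.
move=> g0 AK gd K0.
case: (posnP N) => [N0|N_gt0].
  have noI : forall i : 'I_N, False by move=> [i]; rewrite N0.
  rewrite !big1 => [|i|i]; last 2 first; try by case: (noI i).
  by rewrite mulr0 addr0 mulr_ge0 // dotvv_ge0.
pose i0 := Ordinal N_gt0.
have pos (i : 'I_N) : (i != i0) = (0 < i)%N by rewrite -val_eqE /= lt0n.
have bw : \sum_i bweight delta i * dot (blk z i) (blk z i)
    = delta * \sum_(i < N | (0 < i)%N) dot (blk z i) (blk z i).
  rewrite (bigD1 i0) //= {1}/bweight /= mul0r add0r mulr_sumr.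
  by apply: eq_big => // i; rewrite pos /bweight => ->.
have cardp (k : 'I_N) : (0 < k)%N -> (#|[pred j : 'I_N | (k <= j)%N]| <= N.-1)%N.
  move=> k0; rewrite -[X in (_ <= X.-1)%N]card_ord -(cardC1 i0); apply: subset_leq_card.
  apply/fintype.subsetP => j; rewrite !inE pos => kj; exact: leq_trans k0 kj.
rewrite bw (bigD1 i0) //= mulrDr lerD2l.
set S := \sum_(i < N | (0 < i)%N) _.
have S0 : 0 <= S by apply: sumr_ge0 => i _; exact: dotvv_ge0.
have tail_le (k : 'I_N) : (0 < k)%N -> dot (tail P k z) (tail P k z) <= N.-1%:R * (K * S).
  move=> k0; apply: le_trans (dot_sum_le _ _) _.
  apply: ler_pM; rewrite ?ler0n //.
  - by apply: sumr_ge0 => i _; exact: dotvv_ge0.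
  - by rewrite ler_nat; exact: cardp.
  rewrite /S mulr_sumr [leRHS](bigID (fun j : 'I_N => (k <= j)%N)) /= ler_wpDr //.
    by apply: sumr_ge0 => i _; rewrite mulr_ge0 // dotvv_ge0.
  rewrite [leLHS](eq_bigl (fun j : 'I_N => (0 < j)%N && (k <= j)%N)).
    by apply: ler_sum => j /andP[j0 _]; exact: AK.
  by move=> j; rewrite andb_idl // => /(leq_trans k0).
have : \sum_(i < N | i != i0) dot (tail P i z) (tail P i z) <= N.-1%:R ^+ 2 * K * S.
  rewrite expr2 -!mulrA [leRHS]mulr_natl.
  rewrite -[X in _ *+ X.-1]card_ord -(cardC1 i0) -sumr_const.
  by apply: ler_sum => i; rewrite pos; exact: tail_le.
move=> h; apply: le_trans (ler_wpM2l g0 h) _.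
by rewrite mulrA ler_wpM2r.
Qed.

(** The primal half of the analysis of one iteration.  The constant [K] bounds the
    squared operator norms of the blocks [A_j] other than the first. *)
Lemma prox_admm_step x0 x lam y xs lams :
  let Q := perturbed P delta x0 in
  let xp := (prox_admm Q gamma H x lam y).1 in
  let lamp := (prox_admm Q gamma H x lam y).2 in
  compact_convex_sets P -> convexity_assumption P Lx ->
  (forall i, (H i)^T = H i) -> 0 < gamma -> 0 <= K -> 0 <= delta ->
  (forall i : 'I_N, (0 < i)%N -> forall v,
     dot (Ablk P i *m v) (Ablk P i *m v) <= K * dot v v) ->
  gamma * (N.-1%:R ^+ 2 * K) <= delta ->
  Yset P y -> Xset P x -> Xset P xs -> Amx P *m xs = avec P ->
  Xset P xp /\
  Phi P xp y - dot lams (residual P xp)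
    <= Phi P xs y
       + 2^-1 * \sum_i bweight delta i * dot (blk (xs - x0) i) (blk (xs - x0) i)
       + (lyapunov_admm xs lams x lam - lyapunov_admm xs lams xp lamp)
       - 2^-1 * sqnorm_blk (xp - x) + Lx / 2 * dot (xp - x) (xp - x).
Proof.
move=> Q xp lamp sets_ok [_ hconv _ Psiconv Psilip] symH g0 K0 delta0 AK gd.
move=> Yy Xx Xxs feas.
have [Xc Xcv _ _] := sets_ok.
have var i := prox_admm_variational delta x0 gamma x lam (Xc i) (Xcv i)
  (hconv y Yy i).1 (hconv y Yy i).2 (symH i) (Xxs i).
have Xxp : Xset P xp by move=> i; exact: (var i).1.
split=> //.
pose g := gradx_Psi P x y.
(* The tails of the error after and before the step. *)
pose v k := tail P k (xp - xs); pose u k := tail P k (x - xs).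
have resE : residual P xp = v 0 by exact: residual_feasible.
have Ae i : Ablk P i *m (blk xs i - blk xp i) = - (v i - v i.+1).
  by rewrite /v tailS addrK -blkB -(opprB xp) /blk submxcolN mulmxN.
have tailE i : residual P xp - tail P i.+1 xp + tail P i.+1 x
    = v 0 - (v i.+1 - u i.+1).
  rewrite resE /v /u !tailB; set a := tail P 0 xp - _; set b := tail _ _ xs.
  by apply/colP => k; rewrite !mxE; ring.
have vi i : 0 <= (hfun P i (blk xs i) y - hfun P i (blk xp i) y)
  + 2^-1 * (bweight delta i * dot (blk (xs - x0) i) (blk (xs - x0) i)
            - bweight delta i * dot (blk (xp - xs) i) (blk (xp - xs) i))
  + dot (blk (xs - xp) i) (blk g i)
  + dot (v i - v i.+1) (lam - gamma *: v 0)
  + gamma / 2 * (dot (u i.+1) (u i.+1) - dot (v i.+1) (v i.+1) + dot (v i) (v i))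
  + 2^-1 * (sqnorm_mx (H i) (blk (xs - x) i) - sqnorm_mx (H i) (blk (xs - xp) i)
            - sqnorm_mx (H i) (blk (xp - x) i)).
  have [_] := var i; rewrite -/Q -/xp -/g Ae tailE => h.
  have bw0 : 0 <= bweight delta i by rewrite /bweight; case: ifP.
  have t1 := three_points (blk xs i) (blk xp i) (blk x0 i) (trmx1 R (d i)).
  rewrite /sqnorm_mx !mul1mx in t1.
  have := mulr_ge0 bw0 (dotvv_ge0 (blk xp i - blk x0 i)).
  have t2 := three_points (blk xs i) (blk xp i) (blk x i) (symH i).
  have t3 := dot_four_points (v i) (v i.+1) (u i.+1).
  have -> : dot (blk (xp - xs) i) (blk (xp - xs) i) =
      dot (blk xs i - blk xp i) (blk xs i - blk xp i).
    by rewrite blkB -(opprB (blk xs i)) dotNl dotNr opprK.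
  have t1b := congr1 ( *%R (bweight delta i)) t1.
  have t3g := ler_wpM2l (ltW g0) t3.
  move: h t1b t2 t3g; rewrite !blkB dotNr dotNl (dotC lam).
  rewrite (dotDr _ (v 0)) dotNr (dotDr _ lam) dotNr dotZr.
  by move=> *; lra.
(* The conditions of all the blocks are added; the sum of the increments of [v] is
   [v 0], since [v N] = 0. *)
have := sumr_ge0 (index_enum 'I_N) (P := xpredT) (fun i _ => vi i).
rewrite !big_split /= -!mulr_sumr !sumrB !big_split /= !sumrN -dot_blk.
have -> : \sum_(i < N) dot (v i - v i.+1) (lam - gamma *: v 0)
    = dot (v 0) (lam - gamma *: v 0).
  under eq_bigr do rewrite dotC; rewrite -dot_sumr dotC; congr dot.
  rewrite -(big_mkord xpredT (fun i => v i - v i.+1)).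
  have -> : v 0 = - (v N - v 0) by rewrite /v tailN sub0r opprK.
  by rewrite -(telescope_sumr _ (leq0n N)) -sumrN; apply: eq_bigr => i _; rewrite opprB.
have absorb := sum_tail_le (xp - xs) (ltW g0) AK gd K0.
(* The term - gamma / 2 |v 0|^2 cancels the contribution of [v 0] left by the
   coupling terms. *)
have lagrange : dot (v 0) (lam - gamma *: v 0) - dot lams (v 0)
    = (2 * gamma)^-1 * (dot (lam - lams) (lam - lams) - dot (lamp - lams) (lamp - lams))
      - gamma / 2 * dot (v 0) (v 0).
  have -> : lamp - lams = (lam - lams) + (- gamma) *: v 0.
    by rewrite /lamp /= -resE scaleNr addrAC.
  rewrite dot_sqDZ !dotBE (dotC (v 0) lam) (dotC (v 0) lams).
  by field; rewrite gt_eqF.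
have [Psid Psic] := Psiconv y Yy.
have XP := Xset_convex sets_ok.
have gradP z : Xset P z -> is_grad_on (Xset P) (fun x => Psi P x y) z (gradx_Psi P z y).
  by move=> Xz; exact: grad_onP.
have lower := convex_grad_on XP Psic (gradP x Xx) Xx Xxs.
have upper := descent_lemma XP Psic gradP
  (fun a b Xa Xb => Psilip a b y Xa Xb Yy) Xx Xxp.
have gsplit : dot (xs - xp) g = dot g (xs - x) - dot g (xp - x).
  by rewrite dotC !dotBE; ring.
move: absorb lagrange lower upper.
rewrite gsplit resE /lyapunov_admm /Phi /sqnorm_blk -/g.
by rewrite /v /u => *; lra.
Qed.

End ProxAdmmStep.

(** * The iterations of the algorithm *)

Section ExtraGradient.
Context {R : realType} {m : nat}.
Variables (Y : set 'cV[R]_m) (G : 'M[R]_m).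
Hypotheses (Y_compact : compact Y) (Y_convex : convex_set Y) (G_pd : pd G).

(** The proximal ascent step from [y] in the direction [g], for the metric [G]; on
    the dual set of a problem this is [ystep]. *)
Definition prox_dual (y g : 'cV[R]_m) : 'cV[R]_m :=
  argmin Y (fun w => 2^-1 * sqnorm_mx G (w - (y + invmx G *m g))).

Lemma prox_dual_variational y g : Y !=set0 ->
  Y (prox_dual y g) /\
  forall w, Y w -> dot (w - prox_dual y g) g
    <= dot (w - prox_dual y g) (G *m (prox_dual y g - y)).
Proof.
move=> Y0; set b := y + invmx G *m g.
pose q (w : 'cV[R]_m) := 2^-1 * sqnorm_mx G (w - b).
have conv0 : convex_function Y (fun=> 0).
  by move=> t x z _ _; rewrite convRE !mulr0 addr0.
have cq : continuous q.
  have -> : q = fun w => 2^-1 * dot (1%:M *m w + - b) (G *m w + - (G *m b)).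
    by apply/funext => w; rewrite /q /sqnorm_mx mul1mx mulmxBr.
  apply: fct_scaler_continuous.
  by apply: dot_continuous => j; exact: affine_continuous.
have := argmin_lscD Y_compact Y0 (@lsc_on_cst _ _ Y 0) cq.
have -> : (fun w => 0 + q w) = q by apply/funext => w; rewrite add0r.
rewrite -[argmin Y q]/(prox_dual y g) => -[Yp pmin]; split; first exact: Yp.
move=> w Yw; set p := prox_dual y g.
pose l := dot (w - p) (G *m (p - b)).
have qE t : q (p + t *: (w - p)) = q p + t * l + t ^+ 2 * (2^-1 * sqnorm_mx G (w - p)).
  rewrite /q addrAC sqnorm_mxDZ; last exact: G_pd.1.
  by rewrite /l; field.
have := argmin_variational Y_convex conv0 Yp Yw pmin qE.
rewrite subrr add0r /l /b opprD addrA [G *m (_ - invmx G *m g)]mulmxBr.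
by rewrite mulKVmx ?pd_unitmx // dotDr dotNr subr_ge0.
Qed.

(** The two dual steps of an iteration start from the same point [y]; the second one
    uses a gradient [g2] evaluated after the first one. *)
Lemma extragradient y g1 g2 yh yp w : Y y -> Y w ->
  yh = prox_dual y g1 -> yp = prox_dual y g2 ->
  2 * dot (w - yh) g2
    <= sqnorm_mx G (w - y) - sqnorm_mx G (w - yp)
       - sqnorm_mx G (yh - y) - sqnorm_mx G (yp - yh)
       + 2 * dot (yp - yh) (g2 - g1).
Proof.
move=> Yy Yw yhE ypE; have Y0 : Y !=set0 by exists y.
have [_ /(_ _ (prox_dual_variational y g2 Y0).1)] := prox_dual_variational y g1 Y0.
have [_ /(_ w Yw)] := prox_dual_variational y g2 Y0.
rewrite -yhE -ypE => h2 h1.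
have t1 := three_points yp yh y G_pd.1.
have t2 := three_points w yp y G_pd.1.
have -> : dot (w - yh) g2 = dot (w - yp) g2 + dot (yp - yh) g2.
  by rewrite -dotDl addrA subrK.
rewrite dotDr dotNr; lra.
Qed.

End ExtraGradient.

Section Algorithm.
Context {R : realType} {N m n : nat} {d : 'I_N -> nat}.
Variables (P : problem R d m n) (Lx Ly gamma delta K : R).
Variables (H : forall i, 'M[R]_(d i)) (G : 'M[R]_m).
Hypotheses (sets_ok : compact_convex_sets P)
  (convexP : convexity_assumption P Lx) (lipschitzP : lipschitz_assumption P Ly)
  (H_pd : forall i, pd (H i)) (H_ge : forall i, psd (H i - (Lx + Ly)%:M))
  (G_pd : pd G) (G_ge : psd (G - Ly%:M)).
Hypotheses (gamma_gt0 : 0 < gamma) (K_ge0 : 0 <= K) (delta_ge0 : 0 <= delta)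
  (A_le : forall i : 'I_N, (0 < i)%N -> forall v,
     dot (Ablk P i *m v) (Ablk P i *m v) <= K * dot v v)
  (gamma_le : gamma * (N.-1%:R ^+ 2 * K) <= delta).

Lemma Phi_convex y : Yset P y -> convex_function (Xset P) (fun x => Phi P x y).
Proof.
move=> Yy; have [_ hconv _ Psiconv _] := convexP.
move=> t x z Xx Xz; rewrite convRE /Phi 2!mulrDr addrACA.
apply: lerD; last by have := (Psiconv y Yy).2 t x z Xx Xz; rewrite convRE.
rewrite !mulr_sumr -big_split; apply: ler_sum => i _ /=.
move: Xx Xz; rewrite !inE => Xx Xz.
have := (hconv y Yy i).1 t (blk x i) (blk z i) (mem_set (Xx i)) (mem_set (Xz i)).
by rewrite convRE; apply: le_trans; rewrite /conv /= blkD !blkZ.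
Qed.

(** The perturbation does not depend on the dual variable. *)
Lemma grady_Phi_perturbed x0 x y :
  grady_Phi (perturbed P delta x0) x y = grady_Phi P x y.
Proof.
rewrite /grady_Phi /grad_on; congr xget.
apply/funext => g; rewrite /mkset /is_grad_on.
have e z : Phi (perturbed P delta x0) x z - Phi (perturbed P delta x0) x y
    = Phi P x z - Phi P x y.
  by rewrite /Phi /= !big_split /=; ring.
have -> // : (fun z => (Phi (perturbed P delta x0) x z - Phi (perturbed P delta x0) x y
    - dot g (z - y)) / enorm (z - y)) =
    (fun z => (Phi P x z - Phi P x y - dot g (z - y)) / enorm (z - y)).
by apply/funext => z; rewrite e.
Qed.

Lemma Phi_concave_grad x y w : Xset P x -> Yset P y -> Yset P w ->
  Phi P x w <= Phi P x y + dot (w - y) (grady_Phi P x y).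
Proof.
move=> Xx Yy Yw; have [Phiconc _ _ _ _] := convexP; have [_ _ _ cY] := sets_ok.
have Hg := grad_onP (lipschitzP.1 x Xx) Yy.
have {}Hg : is_grad_on (Yset P) (fun y => - Phi P x y) y (- grady_Phi P x y).
  move/cvgN : Hg; rewrite oppr0 /is_grad_on.
  set F1 := (X in X @ _); set F2 := (X in _ -> X @ _ --> _).
  have -> // : F1 = F2.
  apply/funext => z; rewrite /F1 /F2 /= -mulNr dotNl; congr (_ / _).
  by rewrite opprfctE /grady_Phi; ring.
have := convex_grad_on cY (Phiconc x Xx).1 Hg Yy Yw.
by rewrite dotNl dotC; lra.
Qed.

(** The error made in the extragradient inequality by using the gradient at an
    earlier point. *)
Lemma grady_Phi_cross x x' y y' z z' : Xset P x -> Xset P x' ->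
  Yset P y -> Yset P y' -> Yset P z -> Yset P z' ->
  2 * dot (z - z') (grady_Phi P x y - grady_Phi P x' y')
    <= Ly * (dot (x - x') (x - x') + dot (y - y') (y - y') + dot (z - z') (z - z')).
Proof.
move=> Xx Xx' Yy Yy' Yz Yz'.
have lip := lipschitzP.2 x x' y y' Xx Xx' Yy Yy'.
rewrite !enorm_sqr in lip.
have := dot_le_enorm (z - z') (grady_Phi P x y - grady_Phi P x' y').
rewrite -(enorm_sqr (z - z')); move: lip.
set e := enorm (z - z'); set s := Num.sqrt _; set D := dot (z - z') _.
set g := enorm _; set ss := _ + dot (y - y') _ => lip De.
have s2 : s ^+ 2 = ss by rewrite sqr_sqrtr // addr_ge0 // dotvv_ge0.
have s0 : 0 <= s by exact: sqrtr_ge0.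
have e0 : 0 <= e by exact: enorm_ge0.
have g0 : 0 <= g by exact: enorm_ge0.
have DL : D <= e * (Ly * s) by apply: le_trans De _; rewrite ler_wpM2l.
rewrite -s2; have [L0|L0] := leP 0 Ly.
  have := mulr_ge0 L0 (sqr_ge0 (e - s)).
  by move: DL; rewrite sqrrB mulr2n; lra.
(* A negative Lipschitz constant forces the sets to be reduced to points. *)
have s_eq0 : s = 0.
  by apply/eqP; rewrite eq_le s0 andbT -(ler_nM2l L0) mulr0 (le_trans g0).
have e_eq0 : e = 0.
  have := lipschitzP.2 x x z z' Xx Xx Yz Yz'.
  rewrite subrr enorm0 expr0n add0r sqrtr_sqr ger0_norm ?enorm_ge0 // -/e => le_e.
  apply/eqP; rewrite eq_le e0 andbT -(ler_nM2l L0) mulr0.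
  exact: le_trans (enorm_ge0 _) le_e.
move: DL; rewrite s_eq0 e_eq0; lra.
Qed.

Section Run.
Variables (x0 xs : 'cV[R]_(\sum_i d i)) (lams : 'cV[R]_n) (ys : 'cV[R]_m).
Hypotheses (Xxs : Xset P xs) (feas : Amx P *m xs = avec P) (Yys : Yset P ys).
Let Q := perturbed P delta x0.

(** The value at [xs] of the perturbation of the objective. *)
Definition prox_weight : R :=
  2^-1 * \sum_i bweight delta i * dot (blk (xs - x0) i) (blk (xs - x0) i).

(** The Lyapunov function of the algorithm, relative to the comparison points [xs]
    and [ys] and to the multiplier [lams]. *)
Definition lyapunov (s : state R d m n) : R :=
  lyapunov_admm P gamma H xs lams (st_x s) (st_lambda s)
  + 2^-1 * sqnorm_mx G (ys - st_y s).

Lemma sqnorm_blk_ge x :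
  (Lx + Ly) * dot x x <= sqnorm_blk H x.
Proof.
rewrite dot_blk mulr_sumr; apply: ler_sum => i _; exact: psd_sub_scalar.
Qed.

Lemma lyapunov_ge0 s : 0 <= lyapunov s.
Proof.
have g0 := ltW gamma_gt0.
rewrite /lyapunov /lyapunov_admm !addr_ge0 // mulr_ge0 ?invr_ge0 ?mulr_ge0 ?dotvv_ge0 //.
- by apply: sumr_ge0 => i _; exact: pd_ge0.
- by apply: sumr_ge0 => i _; exact: dotvv_ge0.
- exact: pd_ge0.
Qed.

Lemma seg_step_descent (s : state R d m n) : Xset P (st_x s) -> Yset P (st_y s) ->
  let s' := seg_step Q gamma H G s in
  let yh := seg_yhat Q G s in
  [/\ Xset P (st_x s'), Yset P (st_y s'), Yset P yh &
    Phi P (st_x s') ys - Phi P xs yh - dot lams (residual P (st_x s'))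
      <= prox_weight + (lyapunov s - lyapunov s')].
Proof.
case: s => x lam y Xx Yy s' yh; rewrite /= in Xx Yy.
have [_ _ cY cvY] := sets_ok.
have Y0 : Yset P !=set0 by exists y.
pose g1 := grady_Phi P x y.
have yhE : yh = prox_dual (Yset P) G y g1.
  by rewrite /yh /seg_yhat /= grady_Phi_perturbed.
have Yyh : Yset P yh.
  by rewrite yhE; exact: (prox_dual_variational cY cvY G_pd y g1 Y0).1.
have [] := prox_admm_step x0 lam lams sets_ok convexP (fun i => (H_pd i).1)
  gamma_gt0 K_ge0 delta_ge0 A_le gamma_le Yyh Xx Xxs feas.
set xl := prox_admm _ _ _ _ _ _.
pose g2 := grady_Phi P xl.1 yh.
pose yp := prox_dual (Yset P) G y g2.
have s'E : s' = State xl.1 xl.2 yp.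
  rewrite /s' /seg_step -/yh -/xl /yp /g2.
  by rewrite -(grady_Phi_perturbed x0).
have Yyp : Yset P yp by exact: (prox_dual_variational cY cvY G_pd y g2 Y0).1.
rewrite s'E /lyapunov; clearbody s' xl yh.
case: xl @g2 @yp {s'E} Yyp => xp lamp g2 yp Yyp Xxp primal.
rewrite /= in g2 yp Yyp Xxp primal *; split=> //.
have dual := extragradient cY cvY G_pd (g2 := g2) (yp := yp) Yy Yys yhE erefl.
have conc := Phi_concave_grad Xxp Yyh Yys; rewrite -/g2 in conc.
have cross := grady_Phi_cross Xxp Xx Yyh Yy Yyp Yyh; rewrite -/g1 -/g2 in cross.
have Hge := sqnorm_blk_ge (xp - x).
have Gge1 := psd_sub_scalar (yh - y) G_ge.
have Gge2 := psd_sub_scalar (yp - yh) G_ge.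
clearbody yp g2 g1; rewrite /prox_weight; lra.
Qed.

Section Ergodic.
Variable y0 : 'cV[R]_m.
Hypotheses (Xx0 : Xset P x0) (Yy0 : Yset P y0).
Let it := seg_iter Q gamma H G x0 y0.

Lemma seg_iter_in k : Xset P (st_x (it k)) /\ Yset P (st_y (it k)).
Proof.
elim: k => [|k [Xk Yk]]; first by split; [exact: Xx0|exact: Yy0].
have [Xk1 Yk1 _ _] := seg_step_descent Xk Yk.
by split; [exact: Xk1|exact: Yk1].
Qed.

Lemma residual_mean T (u : nat -> 'cV[R]_(\sum_i d i)) :
  residual P (T.+1%:R^-1 *: \sum_(k < T.+1) u k)
    = T.+1%:R^-1 *: \sum_(k < T.+1) residual P (u k).
Proof.
rewrite /residual sumrB scalerBr -scalemxAr mulmx_sumr; congr (_ - _).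
rewrite sumr_const card_ord -[avec P *+ _]scaler_nat scalerA mulVf ?scale1r //.
Qed.

Lemma ergodic_bound T :
  let xb := seg_xbar Q gamma H G x0 y0 T.+1 in
  let yb := seg_ybar Q gamma H G x0 y0 T.+1 in
  [/\ Xset P xb, Yset P yb &
    Phi P xb ys - Phi P xs yb - dot lams (residual P xb)
      <= prox_weight + T.+1%:R^-1 * lyapunov (State x0 0 y0)].
Proof.
have [_ _ _ cvY] := sets_ok; have [Phiconc _ _ _ _] := convexP.
pose u k := st_x (it k.+1); pose v k := seg_yhat Q G (it k).
have step k := seg_step_descent (seg_iter_in k).1 (seg_iter_in k).2.
have Xu k : Xset P (u k) by have [] := step k.
have Yv k : Yset P (v k) by have [] := step k.
have [Xb xle] := convex_mean T (Xset_convex sets_ok) (Phi_convex Yys) Xu.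
have [Yb yle] := convex_mean T cvY (Phiconc _ Xxs).1 Yv.
rewrite -/(seg_xbar Q gamma H G x0 y0 T.+1) in Xb xle.
rewrite -/(seg_ybar Q gamma H G x0 y0 T.+1) in Yb yle.
split=> //.
have -> : seg_xbar Q gamma H G x0 y0 T.+1 = T.+1%:R^-1 *: \sum_(k < T.+1) u k by [].
have T0 : 0 < T.+1%:R :> R by rewrite ltr0n.
have total : \sum_(k < T.+1)
      (Phi P (u k) ys - Phi P xs (v k) - dot lams (residual P (u k)))
    <= T.+1%:R * prox_weight + lyapunov (State x0 0 y0).
  have : \sum_(k < T.+1) (prox_weight + (lyapunov (it k) - lyapunov (it k.+1)))
      <= T.+1%:R * prox_weight + lyapunov (State x0 0 y0).
    rewrite big_split sumr_const card_ord (mulr_natl prox_weight) lerD2l.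
    rewrite -(big_mkord xpredT (fun k => lyapunov (it k) - lyapunov (it k.+1))).
    have -> : \sum_(0 <= k < T.+1) (lyapunov (it k) - lyapunov (it k.+1))
        = lyapunov (it 0) - lyapunov (it T.+1).
      rewrite -[RHS]opprB -(telescope_sumr (lyapunov \o it) (leq0n T.+1)) -sumrN.
      by apply: eq_bigr => i _; rewrite opprB.
    by rewrite gerBl lyapunov_ge0.
  by apply: le_trans; apply: ler_sum => k _; have [] := step k.
have Ti : 0 <= T.+1%:R^-1 :> R by rewrite invr_ge0 ltW.
have E L : T.+1%:R^-1 * (T.+1%:R * prox_weight + L) = prox_weight + T.+1%:R^-1 * L.
  by rewrite mulrDr mulKf // gt_eqF.
move: (ler_wpM2l Ti total); rewrite E; apply: le_trans.
rewrite residual_mean dotZr dot_sumr !sumrB !mulrBr lerD2r lerB //.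
by move: yle; rewrite sumrN mulrN lerN2.
Qed.

End Ergodic.

End Run.

End Algorithm.

(** * Bounds independent of the number of iterations *)

Section Bounds.
Context {R : realType}.

Lemma compact_dot_bounded k (D : set 'cV[R]_k) : compact D ->
  exists2 B, 0 <= B & forall u v, D u -> D v -> dot (u - v) (u - v) <= B.
Proof.
move=> cD; have [[w0 Dw0]|D0] := pselect (D !=set0); last first.
  by exists 0 => // u v Du; case: D0; exists u.
(* The squared norm attains its maximum on [D]. *)
have cq : continuous (fun w : 'cV[R]_k => -1 * dot (1%:M *m w + 0) (1%:M *m w + 0)).
  apply: fct_scaler_continuous.
  by apply: dot_continuous => j; exact: affine_continuous.
have := argmin_lscD cD (ex_intro _ w0 Dw0) (@lsc_on_cst _ _ D 0) cq.
set p := argmin _ _ => -[Dp pmax].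
have {}pmax w : D w -> dot w w <= dot p p.
  by move=> /pmax; rewrite !mul1mx !addr0; lra.
exists (4 * dot p p) => [|u v Du Dv]; first by rewrite mulr_ge0 ?dotvv_ge0.
have := dot2_le u (- v); have := pmax u Du; have := pmax v Dv.
by rewrite !dotBE (dotC v u); lra.
Qed.

(** An interior point for the topology of the sup norm is the centre of a Euclidean
    ball. *)
Lemma nbhs_enorm k (D : set 'cV[R]_k) x : D° x ->
  exists2 e, 0 < e & forall z, enorm z <= e -> D (x + z).
Proof.
move=> /nbhs_ballP[r /= r0 rD]; exists (r / 2) => [|z zr]; first by rewrite divr_gt0.
apply: rD; split=> // i j; rewrite /ball /= mxE opprD addrA subrr add0r normrN.
apply: (@le_lt_trans _ _ (enorm z)); last by move: zr r0; lra.
rewrite -(@ler_pXn2r _ 2) ?nnegrE ?enorm_ge0 // enorm_sqr dotE.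
rewrite (bigD1 i) //= ord1 real_normK ?num_real // expr2 lerDl.
by apply: sumr_ge0 => l _; rewrite -expr2 sqr_ge0.
Qed.

End Bounds.

Section ProblemBounds.
Context {R : realType} {N m n : nat} {d : 'I_N -> nat}.
Variable P : problem R d m n.

Lemma Xset_bounded : compact_convex_sets P ->
  exists2 B, 0 <= B &
    forall x x', Xset P x -> Xset P x' -> dot (x - x') (x - x') <= B.
Proof.
move=> [cX _ _ _].
have /choice[B BP] i : exists B : R, 0 <= B /\
    forall u v, Xblk P i u -> Xblk P i v -> dot (u - v) (u - v) <= B.
  by have [B B0 BP] := compact_dot_bounded (cX i); exists B.
exists (\sum_i B i) => [|x x' Xx Xx']; first by apply: sumr_ge0 => i _; case: (BP i).
by rewrite dot_blk; apply: ler_sum => i _; rewrite blkB; apply: (BP i).2.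
Qed.

Lemma sqnorm_blk_le (H : forall i, 'M[R]_(d i)) x :
  sqnorm_blk H x <= (\sum_i frobenius (H i)) * dot x x.
Proof.
rewrite mulr_suml; apply: ler_sum => i _.
rewrite (le_trans (sqnorm_mx_le _ _)) // enorm_sqr ler_wpM2l ?frobenius_ge0 //.
rewrite dot_blk (bigD1 i) //= lerDl; apply: sumr_ge0 => j _; exact: dotvv_ge0.
Qed.

Lemma dot_mulmx_le p q (M : 'M[R]_(p, q)) c v : 0 <= c ->
  enorm (M *m v) <= c * enorm v -> dot (M *m v) (M *m v) <= c ^+ 2 * dot v v.
Proof.
move=> c0 h; rewrite -!enorm_sqr -exprMn ler_pXn2r ?nnegrE ?mulr_ge0 ?enorm_ge0 //.
Qed.

Lemma dot_tail_le k x :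
  dot (tail P k x) (tail P k x)
    <= N%:R * ((\sum_i frobenius (Ablk P i) ^+ 2) * dot x x).
Proof.
apply: le_trans (dot_sum_le _ _) _; apply: ler_pM; rewrite ?ler0n //.
- by apply: sumr_ge0 => i _; exact: dotvv_ge0.
- by rewrite ler_nat -[X in (_ <= X)%N](card_ord N) max_card.
apply: (@le_trans _ _ (\sum_i dot (Ablk P i *m blk x i) (Ablk P i *m blk x i))).
  rewrite [leRHS](bigID (fun j : 'I_N => (k <= j)%N)) /= lerDl.
  by apply: sumr_ge0 => i _; exact: dotvv_ge0.
rewrite mulr_suml; apply: ler_sum => i _.
apply: le_trans (dot_mulmx_le (frobenius_ge0 _) (enorm_mulmx _ _)) _.
rewrite ler_wpM2l ?sqr_ge0 // dot_blk (bigD1 i) //= lerDl.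
by apply: sumr_ge0 => j _; exact: dotvv_ge0.
Qed.

(** Slater's condition gives a linear error bound: any point of X is moved to a
    feasible point, at a cost proportional to the residual, by mixing it with a
    point of X whose residual is opposite and of fixed size. *)
Lemma slater_error_bound Lx : compact_convex_sets P -> slater P ->
  convexity_assumption P Lx ->
  exists2 B, 0 <= B & forall x y, Xset P x -> Yset P y ->
    exists x', [/\ Xset P x', Amx P *m x' = avec P &
      Phi P x' y <= Phi P x y + B * enorm (residual P x)].
Proof.
move=> sets_ok [xh [yh [Xxh _ feas]]] convexP.
have [_ _ [B0 bnd] _ _] := convexP.
have [e e0 eP] := nbhs_enorm Xxh.
(* [M] is a right inverse of A on its range, which contains the residuals. *)
pose M : 'M[R]_(_, n) := (pinvmx (Amx P)^T)^T.
have MP x : Amx P *m (M *m (residual P x)) = residual P x.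
  have rE : residual P x = Amx P *m (x - xh) by rewrite mulmxBr feas.
  apply: trmx_inj; rewrite 2!trmx_mul /M trmxK mulmxKpV // rE trmx_mul.
  exact: submxMl.
pose c := frobenius M + 1.
have c0 : 0 < c by rewrite ltr_wpDl ?frobenius_ge0.
have Mle r : enorm (M *m r) <= c * enorm r.
  by rewrite (le_trans (enorm_mulmx _ _)) // ler_wpM2r ?enorm_ge0 // lerDl.
pose eta := e / c; have eta0 : 0 < eta by rewrite divr_gt0.
have etaE : eta * c = e by rewrite divfK // gt_eqF.
clearbody eta.
exists (2 * `|B0| / eta) => [|x y Xx Yy].
  by rewrite divr_ge0 ?(ltW eta0) ?mulr_ge0.
set r := residual P x.
have [r0|r0] := eqVneq (enorm r) 0.
  exists x; split=> //; last by rewrite r0 mulr0 addr0.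
  by apply/eqP; rewrite -subr_eq0; apply/eqP; exact: enorm_eq0 r0.
have nr : 0 < enorm r by rewrite lt_def r0 enorm_ge0.
(* The point xh + z has residual - (eta / |r|) r, so the convex combination with
   parameter |r| / (|r| + eta) is feasible. *)
pose z := - (eta / enorm r) *: (M *m r).
have Xz : Xset P (xh + z).
  apply: eP; rewrite enormZ normrN ger0_norm ?divr_ge0 ?(ltW nr) ?(ltW eta0) //.
  apply: (@le_trans _ _ (eta / enorm r * (c * enorm r))).
    by rewrite ler_wpM2l ?divr_ge0 ?(ltW nr) ?(ltW eta0).
  by rewrite -etaE le_eqVlt; apply/orP; left; apply/eqP; field; rewrite r0.
pose t := enorm r / (enorm r + eta).
have s0 : 0 < enorm r + eta by rewrite addr_gt0.
have t01 : 0 <= t <= 1.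
  by rewrite divr_ge0 ?(ltW nr) ?(ltW s0) //= ler_pdivrMr // mul1r lerDl ltW.
exists (x + t *: (xh + z - x)); split.
- exact: convex_setP (Xset_convex sets_ok) Xx Xz t01.
- rewrite mulmxDr -scalemxAr mulmxBr mulmxDr feas -scalemxAr MP -/r.
  have -> : Amx P *m x = r + avec P by rewrite /r /residual subrK.
  have -> : avec P + - (eta / enorm r) *: r - (r + avec P)
      = - (eta / enorm r + 1) *: r.
    by apply/colP => k; rewrite !mxE; ring.
  rewrite scalerA addrAC -[X in X + _ + _]scale1r -scalerDl.
  have -> : 1 + t * - (eta / enorm r + 1) = 0.
    by rewrite /t; field; rewrite r0 gt_eqF.
  by rewrite scale0r add0r.
have := convex_functionP (Phi_convex convexP Yy) Xx Xz t01.
move=> /le_trans; apply; rewrite lerD2l.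
have tle : t <= enorm r / eta.
  by rewrite ler_pdivrMr // mulrAC ler_pdivlMr // ler_wpM2l ?(ltW nr) // lerDr (ltW nr).
have diff : Phi P (xh + z) y - Phi P x y <= 2 * `|B0|.
  have := bnd _ _ Xz Yy; have := bnd _ _ Xx Yy; rewrite !ler_norml.
  by have := ler_norm B0; move=> ? /andP[? ?] /andP[? ?]; lra.
apply: (@le_trans _ _ (t * (2 * `|B0|))).
  by rewrite ler_wpM2l //; case/andP: t01.
have := ler_wpM2r (_ : 0 <= 2 * `|B0|) tle.
rewrite mulr_ge0 // => /(_ isT) /le_trans; apply.
by rewrite le_eqVlt; apply/orP; left; apply/eqP; ring.
Qed.

End ProblemBounds.

(** * Convergence *)

Section Convergence.
Context {R : realType} {N m n : nat} {d : 'I_N -> nat}.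
Variables (P : problem R d m n) (Lx Ly c0 : R).
Variables (H : forall i, 'M[R]_(d i)) (G : 'M[R]_m).
Hypotheses (N_gt1 : (1 < N)%N) (sets_ok : compact_convex_sets P)
  (A_neq0 : exists i : 'I_N, (0 < i)%N /\ Ablk P i != 0) (slaterP : slater P)
  (convexP : convexity_assumption P Lx) (lipschitzP : lipschitz_assumption P Ly)
  (c0_gt0 : 0 < c0) (H_pd : forall i, pd (H i))
  (H_ge : forall i, psd (H i - (Lx + Ly)%:M))
  (G_pd : pd G) (G_ge : psd (G - Ly%:M)).

(** The largest squared spectral norm of the blocks of A other than the first. *)
Definition spectral_bound : R :=
  \big[Num.max/0]_(i < N | (0 < i)%N) spectral_norm (Ablk P i) ^+ 2.

Lemma spectral_bound_ge (i : 'I_N) : (0 < i)%N ->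
  spectral_norm (Ablk P i) ^+ 2 <= spectral_bound.
Proof. by move=> i0; rewrite /spectral_bound (bigD1 i) //= le_max lexx. Qed.

Lemma spectral_bound_gt0 : 0 < spectral_bound.
Proof.
have [i [i0 Ai]] := A_neq0; apply: lt_le_trans (spectral_bound_ge i0).
by rewrite exprn_gt0 // spectral_norm_gt0.
Qed.

Lemma spectral_bound_dot (i : 'I_N) v : (0 < i)%N ->
  dot (Ablk P i *m v) (Ablk P i *m v) <= spectral_bound * dot v v.
Proof.
move=> i0; rewrite -enorm_sqr.
apply: (@le_trans _ _ ((spectral_norm (Ablk P i) * enorm v) ^+ 2)).
  rewrite ler_pXn2r ?nnegrE ?enorm_ge0 ?enorm_spectral //.
  exact: le_trans (enorm_ge0 _) (enorm_spectral _ _).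
rewrite exprMn enorm_sqr ler_wpM2r ?dotvv_ge0 //; exact: spectral_bound_ge.
Qed.

(** The multiplier which turns the Lagrangian term into a multiple of the norm of the
    residual. *)
Lemma dual_multiplier k (r : 'cV[R]_k) rho :
  exists lams, dot lams r = - rho * enorm r /\ dot lams lams <= rho ^+ 2.
Proof.
(* When [r] is 0 the division by 0 makes this multiplier 0, as needed. *)
exists (- (rho / enorm r) *: r); rewrite dotZl dotZr dotZl -enorm_sqr.
have [->|r0] := eqVneq (enorm r) 0.
  by rewrite expr0n !mulr0 sqr_ge0.
by split; [field|rewrite le_eqVlt; apply/orP; left; apply/eqP; field].
Qed.

(** The ergodic rate, uniform in the comparison points and in the starting points. *)
Lemma ergodic_rate rho : exists C : R, forall x0 y0, Xset P x0 -> Yset P y0 ->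
  forall T : nat, (1 <= T)%N ->
  let xb := xbar P H G c0 x0 y0 T in
  let yb := ybar P H G c0 x0 y0 T in
  [/\ Xset P xb, Yset P yb &
    forall xs ys, Xset P xs -> Amx P *m xs = avec P -> Yset P ys ->
      Phi P xb ys - Phi P xs yb + rho * enorm (residual P xb)
        <= C / Num.sqrt T%:R].
Proof.
have [BX BX0 BXP] := Xset_bounded sets_ok.
have [BY BY0 BYP] := compact_dot_bounded (let: And4 _ _ cY _ := sets_ok in cY).
pose S := spectral_bound; have S0 : 0 < S := spectral_bound_gt0.
pose kappa := N%:R * (N%:R - 1) * S.
have N0 : 0 < N%:R :> R by rewrite ltr0n ltnW.
have N1 : 0 < N%:R - 1 :> R by rewrite subr_gt0 ltr1n.
have kappa0 : 0 < kappa by rewrite !mulr_gt0.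
pose hF := \sum_i frobenius (H i); pose gF := frobenius G.
pose aF := \sum_i frobenius (Ablk P i) ^+ 2.
have hF0 : 0 <= hF by apply: sumr_ge0 => i _; exact: frobenius_ge0.
have aF0 : 0 <= aF by apply: sumr_ge0 => i _; exact: sqr_ge0.
have gF0 : 0 <= gF by exact: frobenius_ge0.
(* [W] bounds the sum of the squared tails, and [Z] the terms of the initial value
   of the Lyapunov function that stay bounded in T.  The remaining one,
   rho^2 / (2 gamma), grows like sqrt T. *)
pose W := N%:R * (N%:R * (aF * BX)).
have W0 : 0 <= W by rewrite !mulr_ge0 // ltW.
pose Z := 2^-1 * (hF * BX) + c0 / kappa / 2 * W + 2^-1 * (gF * BY).
have Z0 : 0 <= Z.
  by rewrite !addr_ge0 // !mulr_ge0 // ?invr_ge0 ?(ltW c0_gt0) ?(ltW kappa0).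
exists (2^-1 * c0 * BX + kappa * rho ^+ 2 / (2 * c0) + Z).
move=> x0 y0 Xx0 Yy0 [//|T] _ xb yb.
set r := Num.sqrt T.+1%:R.
have T0 : 0 < T.+1%:R :> R by rewrite ltr0n.
have r0 : 0 < r by rewrite sqrtr_gt0.
have r1 : 1 <= r by rewrite -sqrtr1 ler_sqrt // ler1n.
have rT : T.+1%:R = r ^+ 2 by rewrite sqr_sqrtr // ltW.
pose delta := delta_of c0 T.+1; pose gamma := gamma_of P delta.
have deltaE : delta = c0 / r by [].
have delta0 : 0 < delta by rewrite divr_gt0.
have gammaE : gamma = delta / kappa by [].
have gamma0 : 0 < gamma by rewrite divr_gt0.
have gamma_le : gamma * (N.-1%:R ^+ 2 * S) <= delta.
  have -> : N.-1%:R = N%:R - 1 :> R by rewrite -subn1 natrB // ltnW.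
  rewrite gammaE mulrAC ler_pdivrMr // ler_pM2l // /kappa expr2 ler_wpM2r ?(ltW S0) //.
  by rewrite ler_wpM2r ?(ltW N1) // lerBlDr lerDl.
have A_le (i : 'I_N) (i0 : (0 < i)%N) v := spectral_bound_dot v i0.
have bound xs lams ys Xxs feas Yys := ergodic_bound sets_ok convexP lipschitzP
  H_pd H_ge G_pd G_ge gamma0 (ltW S0) (ltW delta0) A_le gamma_le
  lams (xs := xs) (ys := ys) Xxs feas Yys Xx0 Yy0 T.
have [xh [yh [Xh Yh feash]]] := slaterP.
have [Xb Yb _] := bound xh 0 yh (interior_subset Xh) feash (interior_subset Yh).
split=> // xs ys Xxs feas Yys.
have [lams [lamr laml]] := dual_multiplier (residual P xb) rho.
have [_ _] := bound xs lams ys Xxs feas Yys.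
rewrite -/xb -/yb lamr => main.
have weight : prox_weight delta x0 xs <= 2^-1 * (c0 / r * BX).
  rewrite /prox_weight ler_wpM2l // -deltaE.
  apply: (@le_trans _ _ (delta * dot (xs - x0) (xs - x0))); last first.
    by rewrite ler_wpM2l ?(ltW delta0) // BXP.
  rewrite dot_blk mulr_sumr; apply: ler_sum => i _.
  by rewrite ler_wpM2r ?dotvv_ge0 // /bweight; case: ifP => _; [exact: lexx|exact: ltW].
have lyap : lyapunov P gamma H G xs lams ys (State x0 0 y0)
    <= Z + kappa * r / (2 * c0) * rho ^+ 2.
  rewrite /lyapunov /lyapunov_admm /= sub0r dotNl dotNr opprK.
  have h1 : sqnorm_blk H (xs - x0) <= hF * BX.
    by apply: le_trans (sqnorm_blk_le _ _) _; rewrite ler_wpM2l // BXP.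
  have h2 : sqnorm_mx G (ys - y0) <= gF * BY.
    by apply: le_trans (sqnorm_mx_le _ _) _; rewrite enorm_sqr ler_wpM2l // BYP.
  have h3 : \sum_(i < N) dot (tail P i.+1 (x0 - xs)) (tail P i.+1 (x0 - xs)) <= W.
    rewrite /W mulr_natl -[X in _ *+ X](card_ord N) -sumr_const.
    apply: ler_sum => i _; apply: le_trans (dot_tail_le _ _ _) _.
    by rewrite ler_wpM2l ?(ltW N0) // ler_wpM2l // BXP.
  have h4 : gamma / 2 * \sum_(i < N) dot (tail P i.+1 (x0 - xs)) (tail P i.+1 (x0 - xs))
      <= c0 / kappa / 2 * W.
    apply: ler_pM => //; first by rewrite divr_ge0 // ltW.
      by apply: sumr_ge0 => i _; exact: dotvv_ge0.
    rewrite ler_wpM2r // gammaE ler_wpM2r ?invr_ge0 ?(ltW kappa0) // deltaE.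
    by rewrite ler_pdivrMr // ler_peMr // ltW.
  have h5 : (2 * gamma)^-1 * dot lams lams <= kappa * r / (2 * c0) * rho ^+ 2.
    have -> : (2 * gamma)^-1 = kappa * r / (2 * c0).
      by rewrite gammaE deltaE; field; rewrite !gt_eqF.
    by rewrite ler_wpM2l //; apply/ltW; apply: divr_gt0; exact: mulr_gt0.
  by rewrite /Z; lra.
have Tlyap : T.+1%:R^-1 * lyapunov P gamma H G xs lams ys (State x0 0 y0)
    <= (Z + kappa * rho ^+ 2 / (2 * c0)) / r.
  have Ti : 0 <= T.+1%:R^-1 :> R by rewrite invr_ge0 ltW.
  apply: le_trans (ler_wpM2l Ti lyap) _.
  rewrite rT mulrDr [leRHS]mulrDl lerD //.
    rewrite mulrC expr2 invfM mulrA ler_piMr ?divr_ge0 ?(ltW r0) //.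
    by rewrite invf_le1.
  by rewrite le_eqVlt; apply/orP; left; apply/eqP; field; rewrite !gt_eqF.
have -> : (2^-1 * c0 * BX + kappa * rho ^+ 2 / (2 * c0) + Z) / r
   = 2^-1 * (c0 / r * BX) + (Z + kappa * rho ^+ 2 / (2 * c0)) / r.
  by field; rewrite !gt_eqF.
move: main weight Tlyap; rewrite mulNr opprK => main weight Tlyap.
by apply: le_trans main _; exact: lerD.
Qed.

End Convergence.

(** * The duality gap *)

Section Gap.
Context {R : realType} {N m n : nat} {d : 'I_N -> nat}.
Variable P : problem R d m n.

Lemma gap_le x y c : slater P ->
  (forall xs ys, Xset P xs -> Amx P *m xs = avec P -> Yset P ys ->
     Phi P x ys - Phi P xs y <= c) -> gap P x y <= c.
Proof.
move=> [xh [yh [/interior_subset Xh /interior_subset Yh feas]]] h.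
rewrite /gap lerBlDr; apply: ge_sup; first by exists (Phi P x yh), yh.
move=> _ [ys Yys <-]; rewrite -lerBlDl; apply: lb_le_inf.
  by exists (Phi P xh y), xh.
by move=> _ [xs [Xxs fxs] <-]; have := h _ _ Xxs fxs Yys; lra.
Qed.

(** A feasible point almost as good as [x] for [y] bounds the gap from below. *)
Lemma gap_ge Lx x y xs c : convexity_assumption P Lx ->
  Xset P x -> Yset P y -> Xset P xs -> Amx P *m xs = avec P ->
  Phi P xs y <= Phi P x y + c -> - c <= gap P x y.
Proof.
move=> [_ _ [B bnd] _ _] Xx Yy Xxs feas h.
have sup_ge : Phi P x y <= sup [set Phi P x y' | y' in Yset P].
  apply: ub_le_sup; last by exists y.
  by exists B => _ [z Yz <-]; exact: le_trans (ler_norm _) (bnd _ _ Xx Yz).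
have inf_le : inf [set Phi P x' y | x' in [set x' | Xset P x' /\ Amx P *m x' = avec P]]
    <= Phi P xs y.
  apply: ge_inf; last by exists xs.
  exists (- B) => _ [z [Xz _] <-]; rewrite lerNl.
  by apply: le_trans (bnd _ _ Xz Yy); rewrite -normrN ler_norm.
by rewrite /gap; lra.
Qed.

End Gap.

Unset Implicit Arguments.

Theorem corollaryB4 (R : realType) (N m n : nat) (d : 'I_N -> nat)
    (P : problem R d m n) (Lx Ly c0 : R)
    (H : forall i : 'I_N, 'M[R]_(d i)) (G : 'M[R]_m)
    (N_ge3 : (3 <= N)%N)
    (sets_ok : compact_convex_sets P)
    (A_neq0 : exists i : 'I_N, (0 < i)%N /\ Ablk P i != 0)
    (slaterP : slater P)
    (convexP : convexity_assumption P Lx)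
    (lipschitzP : lipschitz_assumption P Ly)
    (c0_gt0 : 0 < c0)
    (H_pd : forall i, pd (H i))
    (H_ge : forall i, psd (H i - (Lx + Ly)%:M))
    (G_pd : pd G)
    (G_ge : psd (G - Ly%:M)) :
  (forall rho : R, 0 < rho ->
     exists C : R, forall x0 y0, Xset P x0 -> Yset P y0 ->
       forall T : nat, (1 <= T)%N ->
         let xb := xbar P H G c0 x0 y0 T in
         let yb := ybar P H G c0 x0 y0 T in
         gap P xb yb + rho * enorm (residual P xb) <= C / Num.sqrt T%:R)
  /\
  (exists C : R, forall x0 y0, Xset P x0 -> Yset P y0 ->
     forall eps : R, 0 < eps <= 1 ->
       exists T : nat, [/\ (1 <= T)%N, T%:R <= C * eps ^- 2 &
         eps_saddle_point P eps
           (xbar P H G c0 x0 y0 T) (ybar P H G c0 x0 y0 T)]).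
Proof.
have N_gt1 : (1 < N)%N by exact: ltn_trans N_ge3.
have rate := ergodic_rate N_gt1 sets_ok A_neq0 slaterP convexP lipschitzP
  c0_gt0 H_pd H_ge G_pd G_ge.
split=> [rho rho0|].
  have [C CP] := rate rho; exists C => x0 y0 Xx0 Yy0 T T1 /=.
  have [_ _ h] := CP x0 y0 Xx0 Yy0 T T1.
  rewrite -lerBrDr; apply: gap_le => // xs ys Xxs feas Yys.
  by rewrite lerBrDr; exact: h.
have [B B0 slack] := slater_error_bound sets_ok slaterP convexP.
have [C CP] := rate (B + 1).
(* [D] / sqrt T bounds the residual, the gap, and B times the residual. *)
pose D := (B + 1) * (`|C| + 1).
have B1 : 1 <= B + 1 by rewrite lerDr.
have D1 : `|C| + 1 <= D by rewrite ler_peMl // addr_ge0.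
have D0 : 0 < D by apply: lt_le_trans D1; rewrite ltr_wpDl.
exists (D ^+ 2 + 1) => x0 y0 Xx0 Yy0 eps /andP[eps0 eps1].
(* T is the least integer with D / sqrt T < eps; the term 1 of the constant pays for
   the rounding because eps <= 1. *)
pose T := (Num.truncn (D ^+ 2 / eps ^+ 2)).+1.
have e2 : 0 < eps ^+ 2 by rewrite exprn_gt0.
have T_ge : D ^+ 2 / eps ^+ 2 <= T%:R by apply/ltW/truncnS_gt.
have T0 : 0 < T%:R :> R by rewrite ltr0n.
have rate_eps : D / Num.sqrt T%:R <= eps.
  rewrite ler_pdivrMr ?sqrtr_gt0 // mulrC -ler_pdivrMr //.
  rewrite -(@ler_pXn2r _ 2) ?nnegrE ?sqrtr_ge0 ?divr_ge0 ?(ltW D0) ?(ltW eps0) //.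
  by rewrite sqr_sqrtr ?(ltW T0) // expr_div_n.
exists T; split=> //.
  rewrite /T -natr1 mulrDl mul1r lerD //.
    by rewrite truncn_le // divr_ge0 ?sqr_ge0.
  by rewrite invf_ge1 // exprn_ile1 // ltW.
have [] := CP x0 y0 Xx0 Yy0 T isT.
set xb := xbar _ _ _ _ _ _ _; set yb := ybar _ _ _ _ _ _ _ => Xb Yb h.
set r := Num.sqrt _ in rate_eps h.
have r0 : 0 < r by rewrite sqrtr_gt0.
have up : gap P xb yb + (B + 1) * enorm (residual P xb) <= C / r.
  by rewrite -lerBrDr; apply: gap_le => // xs ys *; rewrite lerBrDr; exact: h.
have [xs [Xxs feas le_xs]] := slack xb yb Xb Yb.
have low := gap_ge convexP Xb Yb Xxs feas le_xs.
have res0 := enorm_ge0 (residual P xb).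
have CD : (B + 1) * (C / r) <= eps.
  apply: le_trans rate_eps; rewrite mulrA ler_wpM2r ?invr_ge0 ?(ltW r0) // ler_wpM2l //.
    exact: le_trans ler01 B1.
  by have := ler_norm C; lra.
have res : enorm (residual P xb) <= C / r by lra.
have Cr : 0 <= C / r := le_trans res0 res.
have Br := ler_wpM2l B0 res.
have BC := mulr_ge0 B0 Cr.
have Bres := mulr_ge0 B0 res0.
by split=> //; [apply/andP; split|]; lra.
Qed.
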